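(* Let $F:\mathbb{R}^m\to\mathbb{R}^{m'}$ be $C^2$ such that $f=\|F\|^2$ satisfies the Lojasiewicz gradient inequality at each of its critical points, and let $\{x_n\}$ be a sequence constructed by Backtracking New Q-Newton's method SE with $0<\tau<1$. 1) If $\mu(x^* )(1+\tau)<1$ for every critical point $x^*$ of $f$, then either $\lim_{n\to\infty}\|x_n\|=\infty$ or $\{x_n\}$ converges to a critical point of $f$. 2) If $F$ is a polynomial map, then there exists $\tau_0>0$ (depending on $F$) such that for every $0<\tau<\tau_0$ the condition in 1) holds; consequently, for such $\tau$, either $\lim_{n\to\infty}\|x_n\|=\infty$ or $\{x_n\}$ converges to a critical point of $f$.
   Context: $\mathrm{minsp}(A)$ is the minimum absolute value of the eigenvalues of a real symmetric matrix $A$; for invertible symmetric $A$, $pr_{A,\pm}$ are the orthogonal projections onto the spans of eigenvectors with positive/negative eigenvalues; $H(x)=JF(x)$. Backtracking New Q-Newton's method SE with distinct parameters $\delta_0,\dots,\delta_m>0$, $\tau>0$, $\kappa=\frac12\min_{i\ne j}|\delta_i-\delta_j|$: given $x_k$, if $H(x_k)^\intercal F(x_k)=0$ set $x_{k+1}=x_k$. Otherwise, if $\mathrm{minsp}(\nabla^2 f(x_k))>\|F(x_k)\|^\tau$, take the smallest $j$ with $\mathrm{minsp}(\nabla^2f(x_k)+\delta_j\|F(x_k)\|I)\ge\kappa\|F(x_k)\|$ and $A_k=\nabla^2f(x_k)+\delta_j\|F(x_k)\|I$; else take the smallest $j$ with $\mathrm{minsp}(\nabla^2f(x_k)+\delta_j\|F(x_k)\|^\tau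 I)\ge\kappa\|F(x_k)\|^\tau$ and $A_k=\nabla^2f(x_k)+\delta_j\|F(x_k)\|^\tau I$. Set $v_k=A_k^{-1}H(x_k)^\intercal F(x_k)$, $w_k=pr_{A_k,+}v_k-pr_{A_k,-}v_k$, $\widehat{w_k}=w_k/\max\{1,\|w_k\|\}$, $\gamma_k$ the largest $\gamma\in\{2^{-n}:n\ge0\}$ with $f(x_k-\gamma\widehat{w_k})-f(x_k)\le-\gamma\langle\widehat{w_k},H(x_k)^\intercal F(x_k)\rangle$, and $x_{k+1}=x_k-\gamma_k\widehat{w_k}$. A $C^1$ function $g$ satisfies the Lojasiewicz gradient inequality at $x^*$ if there exist a neighbourhood $U$ of $x^*$, $0<\mu<1$, $C>0$ with $|g(x)-g(x^* )|^\mu\le C\|\nabla g(x)\|$ for all $x\in U$. For a critical point $x^*$ of $f$, $\mu(x^* ):=\inf\{\mu:$ there exist a neighbourhood $U$ of $x^*$ and $C>0$ with $|f(x)-f(x^* )|^\mu\le C\|\nabla f(x)\|$ for all $x\in U\}$. *)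

(* Defs.v *)
From mathcomp Require Import all_boot all_order all_algebra.
From mathcomp Require Import all_classical all_reals all_analysis.
From mathcomp Require mpoly.

Set Implicit Arguments.
Unset Strict Implicit.
Unset Printing Implicit Defensive.

Import Order.TTheory GRing.Theory Num.Theory.
Import numFieldNormedType.Exports.
Local Open Scope ring_scope.
Local Open Scope classical_set_scope.

Definition dotv {R : realType} {n : nat} (u v : 'cV[R]_n) : R :=
  \sum_(i < n) u i 0 * v i 0.

Definition enorm {R : realType} {n : nat} (u : 'cV[R]_n) : R :=
  Num.sqrt (dotv u u).

Definition evec {R : realType} {m : nat} (j : 'I_m) : 'cV[R]_m := delta_mx j 0.

Definition sqnormF {R : realType} {m m' : nat} (F : 'cV[R]_m -> 'cV[R]_m')
  (x : 'cV[R]_m) : R := enorm (F x) ^+ 2.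

Definition grad {R : realType} {m : nat} (g : 'cV[R]_m -> R) (x : 'cV[R]_m)
  : 'cV[R]_m := \col_(i < m) derive g x (evec i).

Definition hess {R : realType} {m : nat} (g : 'cV[R]_m -> R) (x : 'cV[R]_m)
  : 'M[R]_m := \matrix_(i < m, j < m) derive (fun y => derive g y (evec j)) x (evec i).

Definition jac {R : realType} {m m' : nat} (F : 'cV[R]_m -> 'cV[R]_m')
  (x : 'cV[R]_m) : 'M[R]_(m', m) :=
  \matrix_(i < m', j < m) (derive F x (evec j)) i 0.

Definition C2 {R : realType} {m m' : nat} (F : 'cV[R]_m -> 'cV[R]_m') : Prop :=
  continuous F /\
  (forall j : 'I_m, (forall x, derivable F x (evec j)) /\
     continuous (fun x => derive F x (evec j))) /\
  (forall i j : 'I_m,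
     (forall x, derivable (fun y => derive F y (evec j)) x (evec i)) /\
     continuous (fun x => derive (fun y => derive F y (evec j)) x (evec i))).

Definition critical {R : realType} {m : nat} (g : 'cV[R]_m -> R) (x : 'cV[R]_m)
  : Prop := grad g x = 0.

Definition lojasiewicz_at {R : realType} {m : nat} (g : 'cV[R]_m -> R)
  (x0 : 'cV[R]_m) : Prop :=
  exists mu : R, 0 < mu < 1 /\ exists C : R, 0 < C /\
    \forall x \near x0, `|g x - g x0| `^ mu <= C * enorm (grad g x).

Definition loj_exponent {R : realType} {m : nat} (g : 'cV[R]_m -> R)
  (x0 : 'cV[R]_m) : R :=
  inf [set mu : R | 0 < mu /\ exists C : R, 0 < C /\
    \forall x \near x0, `|g x - g x0| `^ mu <= C * enorm (grad g x)].

Definition minsp {R : realType} {m : nat} (A : 'M[R]_m) : R :=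
  inf [set `|l| | l in [set l : R | eigenvalue A l]].

Definition eig_span {R : realType} {m : nat} (A : 'M[R]_m) (P : R -> Prop)
  (u : 'cV[R]_m) : Prop :=
  exists (k : nat) (c : 'I_k -> R) (e : 'I_k -> 'cV[R]_m),
    (forall i, exists l : R, P l /\ A *m e i = l *: e i) /\
    u = \sum_(i < k) c i *: e i.

Definition orth_proj {R : realType} {m : nat} (S : 'cV[R]_m -> Prop)
  (v p : 'cV[R]_m) : Prop :=
  S p /\ forall u, S u -> dotv (v - p) u = 0.

Definition kappa {R : realType} {m : nat} (delta : 'I_m.+1 -> R) : R :=
  inf [set d : R | exists i j : 'I_m.+1, i != j /\ d = `|delta i - delta j|] / 2.

Definition choose_A {R : realType} {m m' : nat} (F : 'cV[R]_m -> 'cV[R]_m')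
  (delta : 'I_m.+1 -> R) (tau : R) (x : 'cV[R]_m) (A : 'M[R]_m) : Prop :=
  let M := hess (sqnormF F) x in
  let nF := enorm (F x) in
  let s := if minsp M > nF `^ tau then nF else nF `^ tau in
  exists j : 'I_m.+1,
    kappa delta * s <= minsp (M + (delta j * s)%:M) /\
    (forall i : 'I_m.+1, (i < j)%N -> minsp (M + (delta i * s)%:M) < kappa delta * s) /\
    A = M + (delta j * s)%:M.

Definition armijo {R : realType} {m m' : nat} (F : 'cV[R]_m -> 'cV[R]_m')
  (x wh : 'cV[R]_m) (gamma : R) : Prop :=
  sqnormF F (x - gamma *: wh) - sqnormF F x <=
    - gamma * dotv wh ((jac F x)^T *m F x).

Definition bnqn_step {R : realType} {m m' : nat} (F : 'cV[R]_m -> 'cV[R]_m')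
  (delta : 'I_m.+1 -> R) (tau : R) (x x' : 'cV[R]_m) : Prop :=
  let g := (jac F x)^T *m F x in
  (g = 0 /\ x' = x) \/
  (g <> 0 /\
   exists (A : 'M[R]_m) (p q : 'cV[R]_m) (gamma : R),
     choose_A F delta tau x A /\
     let v := invmx A *m g in
     orth_proj (eig_span A (fun l => 0 < l)) v p /\
     orth_proj (eig_span A (fun l => l < 0)) v q /\
     let w := p - q in
     let wh := (Num.max 1 (enorm w))^-1 *: w in
     ((exists n : nat, gamma = (2%:R ^- n)) /\ armijo F x wh gamma /\
      (forall n : nat, armijo F x wh (2%:R ^- n) -> 2%:R ^- n <= gamma)) /\
     x' = x - gamma *: wh).

Definition bnqn_params {R : realType} {m : nat} (delta : 'I_m.+1 -> R) : Prop :=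
  injective delta /\ forall i, 0 < delta i.

Definition bnqn_seq {R : realType} {m m' : nat} (F : 'cV[R]_m -> 'cV[R]_m')
  (delta : 'I_m.+1 -> R) (tau : R) (x : nat -> 'cV[R]_m) : Prop :=
  forall k, bnqn_step F delta tau (x k) (x k.+1).

Definition diverges_or_converges_crit {R : realType} {m m' : nat}
  (F : 'cV[R]_m -> 'cV[R]_m') (x : nat -> 'cV[R]_m) : Prop :=
  ((fun n => enorm (x n)) @ \oo --> +oo) \/
  (exists xs : 'cV[R]_m, critical (sqnormF F) xs /\ x @ \oo --> xs).

Definition polynomial_map {R : realType} {m m' : nat}
  (F : 'cV[R]_m -> 'cV[R]_m') : Prop :=
  exists P : 'I_m' -> mpoly.mpoly m R,
    forall x i, F x i 0 = mpoly.meval (fun j => x j 0) (P i).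

(* Main.v *)
Require Import Defs.
From mathcomp Require Import all_boot all_order all_algebra.
From mathcomp Require Import all_classical all_reals all_analysis.
From mathcomp Require Import ring lra zify complex.
From mathcomp Require ordered_qelim qe_rcf mpoly spectral mxred sesquilinear.

(** Let [g] be half the gradient of [f = |F|^2].  In an eigenbasis of the
    symmetric matrix [A] the search direction is [w = |A|^-1 g], so that
    [<w, g> >= sigma |w|^2] and [|g|^2 <= M <w, g>] when the spectrum of [A] has
    absolute values in [[sigma, M]]; hence every step satisfies
    [f(x) - f(x') >= sqrt (sigma / M) |g(x)| |x' - x|].  Near a cluster point [y]
    one may take [sigma] constant if [F y <> 0] and [sigma] proportional to
    [|F|^tau] if [F y = 0].  Combined with the Lojasiewicz inequality of exponent
    [mu] this gives [f(x) - f(x') >= a (f(x) - f(y))^theta |x' - x|] with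
    [theta = mu], respectively [theta = mu + tau / 4], and [theta < 1] because
    [mu (1 + tau) < 1]; the usual length argument then forces [x_n --> y].

    For polynomial [F] the exponents must be bounded away from [1] uniformly over
    a possibly unbounded critical set.  The infimum [y] of [|grad f|^2] on
    [{x in a box around x0 | |f x - f x0| = t}] is definable, so by quantifier
    elimination [(t, y)] is a zero of a nonzero polynomial whose degree [D] does
    not depend on [x0].  By a Newton polygon argument [y^q] is then at least
    of the order [t^p] with [q <= D]; the given inequality with some exponent
    less than [1] forces [p < 2 q], hence [p <= 2 q - 1], which improves the
    exponent to [1 - 1 / (2 D)]. *)

Set Implicit Arguments.
Unset Strict Implicit.
Unset Printing Implicit Defensive.

Import Order.TTheory GRing.Theory Num.Theory.
Import numFieldNormedType.Exports.
Local Open Scope ring_scope.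
Local Open Scope classical_set_scope.

(** * Quantifier elimination and bivariate polynomials *)

Section bivariate.
Variable R : realType.
Implicit Types (p q : {poly {poly R}}) (t y : R) (e : seq R).

(** The outer variable is [y] and the coefficients are polynomials in [t]: coefficient number [i] of
    coefficient number [j] of [p] belongs to the monomial t^i y^j. *)
Definition eval2 p t y : R := p.[y%:P].[t].

Definition bideg (D : nat) p : Prop :=
  (size p <= D.+1)%N /\ forall i, (size (p`_i)%R <= D.+1)%N.

Lemma bideg_le (D D' : nat) p : (D <= D')%N -> bideg D p -> bideg D' p.
Proof. by move=> DD' [h1 h2]; split=> [|i]; [lia|have := h2 i; lia]. Qed.

Lemma bidegC (c : R) : bideg 0 c%:P%:P.
Proof.
split=> [|i]; first by rewrite size_polyC leq_b1.
rewrite coefC; case: ifP => _; last by rewrite size_poly0.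
by rewrite size_polyC leq_b1.
Qed.

Lemma bidegX : bideg 1 'X.
Proof.
split=> [|i]; first by rewrite size_polyX.
by rewrite coefX; case: eqP => _; rewrite ?size_poly1 ?size_poly0.
Qed.

Lemma bidegXC : bideg 1 ('X)%:P.
Proof.
split=> [|i]; first by rewrite size_polyC; case: (_ == _).
by rewrite coefC; case: ifP => _; rewrite ?size_polyX ?size_poly0.
Qed.

Lemma bidegD (D : nat) p q : bideg D p -> bideg D q -> bideg D (p + q).
Proof.
move=> [p1 p2] [q1 q2]; split=> [|i].
  by rewrite (leq_trans (size_polyD _ _))// geq_max p1.
by rewrite coefD (leq_trans (size_polyD _ _))// geq_max p2 q2.
Qed.

Lemma bidegN (D : nat) p : bideg D p -> bideg D (- p).
Proof.
move=> [p1 p2]; split=> [|i]; first by rewrite size_polyN.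
by rewrite coefN size_polyN.
Qed.

Lemma bidegM (D D' : nat) p q : bideg D p -> bideg D' q -> bideg (D + D') (p * q).
Proof.
move=> [p1 p2] [q1 q2]; split=> [|i].
  by rewrite (leq_trans (size_polyMleq _ _))//; lia.
rewrite coefM; apply: (leq_trans (size_sum _ _ _)); apply/bigmax_leqP => j _.
apply: (leq_trans (size_polyMleq _ _)).
by have := p2 j; have := q2 (i - j)%N; lia.
Qed.

(** The bound [D] is read off the syntax of [u] before the parameters [e] are known, since these
    enter only as coefficients. This is the origin of all later uniformity. *)
Lemma rterm_bivariate (u : GRing.term R) : GRing.rterm u ->
  exists D, forall e, exists2 p, bideg D p &
    forall t y, GRing.eval (t :: y :: e) u = eval2 p t y.
Proof.
elim: u => //=.
- case=> [|[|n]] _.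
  + by exists 1%N => e; exists 'X%:P; [exact: bidegXC|move=> t y; rewrite /eval2 !hornerE].
  + by exists 1%N => e; exists 'X; [exact: bidegX|move=> t y; rewrite /eval2 !hornerE].
  + exists 0%N => e; exists (e`_n)%:P%:P; first exact: bidegC.
    by move=> t y; rewrite /eval2 !hornerE.
- move=> c _; exists 0%N => e; exists c%:P%:P; first exact: bidegC.
  by move=> t y; rewrite /eval2 !hornerE.
- move=> n _; exists 0%N => e; exists (n%:R)%:P%:P; first exact: bidegC.
  by move=> t y; rewrite /eval2 !hornerE.
- move=> u1 IH1 u2 IH2 /andP[/IH1[D1 h1] /IH2[D2 h2]].
  exists (D1 + D2)%N => e; have [p1 b1 e1] := h1 e; have [p2 b2 e2] := h2 e.
  exists (p1 + p2).
    by apply: bidegD; [apply: bideg_le b1|apply: bideg_le b2]; lia.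
  by move=> t y; rewrite e1 e2 /eval2 !hornerE.
- move=> u1 IH1 /IH1[D1 h1]; exists D1 => e; have [p1 b1 e1] := h1 e.
  exists (- p1); first exact: bidegN.
  by move=> t y; rewrite e1 /eval2 !hornerE.
- move=> u1 IH1 n /IH1[D1 h1]; exists D1 => e; have [p1 b1 e1] := h1 e.
  exists (p1 *+ n); last by move=> t y; rewrite e1 /eval2 !hornerMn.
  elim: n => [|n IHn]; last by rewrite mulrS; exact: bidegD.
  by rewrite mulr0n -polyC0 -polyC0; apply: bideg_le (bidegC _).
- move=> u1 IH1 u2 IH2 /andP[/IH1[D1 h1] /IH2[D2 h2]].
  exists (D1 + D2)%N => e; have [p1 b1 e1] := h1 e; have [p2 b2 e2] := h2 e.
  exists (p1 * p2); first exact: bidegM.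
  by move=> t y; rewrite e1 e2 /eval2 !hornerE.
- move=> u1 IH1 n /IH1[D1 h1]; exists (n * D1)%N => e; have [p1 b1 e1] := h1 e.
  exists (p1 ^+ n); last by move=> t y; rewrite e1 /eval2 !horner_exp.
  elim: n => [|n IHn]; last by rewrite exprS mulSn; exact: bidegM.
  by rewrite expr0 mul0n -polyC1 -polyC1; exact: bidegC.
Qed.

Lemma eval2_continuous p t : continuous (eval2 p t).
Proof.
have -> : eval2 p t = horner (map_poly (horner_eval t) p).
  apply/funext => y; rewrite /eval2 -[in RHS](hornerC y t) -horner_evalE.
  by rewrite horner_map/= horner_evalE.
exact: continuous_horner.
Qed.

Lemma eval2_sign_locally_constant p t y : eval2 p t y != 0 ->
  exists2 eps, 0 < eps & forall y', `|y' - y| < eps ->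
    Num.sg (eval2 p t y') = Num.sg (eval2 p t y).
Proof.
move=> pn0; have /cvgrPdist_lt := @eval2_continuous p t y.
move=> /(_ `|eval2 p t y|); rewrite normr_gt0 => /(_ pn0).
move=> /nbhs_ballP[eps /= eps0 h]; exists eps => // y' yy'.
have := h y'; rewrite /ball/= distrC => /(_ yy').
case: (ltgtP 0 (eval2 p t y)) pn0 => // p0 _ hy.
- by rewrite !gtr0_sg//; move: hy; rewrite (gtr0_norm p0) ltr_norml; lra.
- by rewrite !ltr0_sg//; move: hy; rewrite (ltr0_norm p0) ltr_norml; lra.
Qed.

(* The truth value of a quantifier-free formula can only change where one of its
   nonzero atoms vanishes; the bound [D] is uniform in the parameters [e]. *)
Definition algebraically_varying (a : seq R -> bool) : Prop :=
  exists D, forall e, exists p, [/\ p != 0, bideg D p &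
    forall t y, eval2 p t y != 0 -> exists2 eps : R, 0 < eps &
      forall y', `|y' - y| < eps -> a (t :: y' :: e) = a (t :: y :: e)].

Lemma algebraically_varying_sg (u1 u2 : GRing.term R) (b : R -> bool) :
  GRing.rterm u1 -> GRing.rterm u2 -> algebraically_varying
    (fun e => b (Num.sg (GRing.eval e u1 - GRing.eval e u2))).
Proof.
move=> /rterm_bivariate[D1 h1] /rterm_bivariate[D2 h2].
exists (D1 + D2)%N => e; have [p1 b1 e1] := h1 e; have [p2 b2 e2] := h2 e.
have aE t y : GRing.eval (t :: y :: e) u1 - GRing.eval (t :: y :: e) u2 =
    eval2 (p1 - p2) t y by rewrite e1 e2 /eval2 !hornerE.
(* If the polynomial of the atom vanishes identically, its truth value is constant and the nonzero
   polynomial 1 serves. *)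
have [p12|p12] := eqVneq (p1 - p2) 0.
  exists 1; split; first exact: oner_neq0.
    by rewrite -polyC1 -polyC1; apply: bideg_le (bidegC _); lia.
  move=> t y _; exists 1 => // y' _.
  by rewrite !aE p12 /eval2 !hornerE.
exists (p1 - p2); split => //.
  by apply: bidegD; [apply: bideg_le b1; lia|apply: bidegN; apply: bideg_le b2; lia].
move=> t y /eval2_sign_locally_constant[eps eps0 h]; exists eps => // y' /h.
by rewrite !aE => ->.
Qed.

(** Where the product of the two polynomials is nonzero, both truth values are locally constant,
    hence so is any Boolean combination of them. *)
Lemma algebraically_varying_op (a1 a2 : seq R -> bool) (b : bool -> bool -> bool) :
  algebraically_varying a1 -> algebraically_varying a2 ->
  algebraically_varying (fun e => b (a1 e) (a2 e)).
Proof.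
move=> [D1 h1] [D2 h2]; exists (D1 + D2)%N => e.
have [p1 [n1 b1 l1]] := h1 e; have [p2 [n2 b2 l2]] := h2 e.
exists (p1 * p2); split; [by rewrite mulf_neq0|exact: bidegM|].
move=> t y; rewrite /eval2 !hornerE mulf_eq0 negb_or => /andP[].
move=> /l1[eps1 eps10 k1] /l2[eps2 eps20 k2].
exists (Num.min eps1 eps2); first by rewrite lt_min eps10.
by move=> y'; rewrite lt_min => /andP[/k1-> /k2->].
Qed.

Lemma qf_algebraically_varying (g : ordered_qelim.ord.formula R) :
  ordered_qelim.ord.qf_form g -> ordered_qelim.ord.rformula g ->
  algebraically_varying (fun e => ordered_qelim.ord.qf_eval e g).
Proof.
elim: g => //=.
- move=> b _ _; exists 0%N => e; exists 1; split; first exact: oner_neq0.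
    by rewrite -polyC1 -polyC1; exact: bidegC.
  by move=> t y _; exists 1.
- move=> u1 u2 _ /andP[r1 r2].
  have := algebraically_varying_sg (fun s => s == 0) r1 r2.
  by under [X in algebraically_varying X]eq_fun do rewrite sgr_eq0 subr_eq0.
- move=> u1 u2 _ /andP[r1 r2].
  have := algebraically_varying_sg (fun s => s < 0) r1 r2.
  by under [X in algebraically_varying X]eq_fun do rewrite sgr_lt0 subr_lt0.
- move=> u1 u2 _ /andP[r1 r2].
  have := algebraically_varying_sg (fun s => s <= 0) r1 r2.
  by under [X in algebraically_varying X]eq_fun do rewrite sgr_le0 subr_le0.
- move=> g1 IH1 g2 IH2 /andP[q1 q2] /andP[r1 r2].
  exact: (algebraically_varying_op andb (IH1 q1 r1) (IH2 q2 r2)).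
- move=> g1 IH1 g2 IH2 /andP[q1 q2] /andP[r1 r2].
  exact: (algebraically_varying_op orb (IH1 q1 r1) (IH2 q2 r2)).
- move=> g1 IH1 g2 IH2 /andP[q1 q2] /andP[r1 r2].
  exact: (algebraically_varying_op implb (IH1 q1 r1) (IH2 q2 r2)).
- move=> g1 IH1 q1 r1.
  exact: (algebraically_varying_op (fun a _ => ~~ a) (IH1 q1 r1) (IH1 q1 r1)).
Qed.

Lemma rcf_quantifier_elim (f : ordered_qelim.ord.formula R) :
  ordered_qelim.ord.rformula f ->
  exists2 g, ordered_qelim.ord.qf_form g && ordered_qelim.ord.rformula g &
    forall e, ordered_qelim.ord.holds e f <-> ordered_qelim.ord.qf_eval e g.
Proof.
move=> rf; eexists; last first.
  move=> e; apply: rwP; apply: ordered_qelim.ord.quantifier_elim_rformP rf.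
    exact: qe_rcf.wf_QE_wproj.
  exact: qe_rcf.valid_QE_wproj.
exact: ordered_qelim.ord.quantifier_elim_wf (@qe_rcf.wf_QE_wproj R) _ rf.
Qed.

End bivariate.

(** * Newton polygon estimate for zeros of bivariate polynomials *)

Section newton.
Variable R : realType.
Implicit Types (p q : {poly {poly R}}) (t y b : R).

(** Cancelling the common power of [y] makes y^q comparable with a power of [t], where q = j - j'.
    The case q = 0 would compare two distinct powers of [t], which t < b excludes. Otherwise the
    exponent of [t] is less than 2q, because [y] is large compared with t^2. *)
Lemma comparable_monomials (D i j i' j' : nat) b t y :
  (i, j) <> (i', j') -> (j <= D)%N -> (j' <= D)%N ->
  0 < b <= 1 -> 0 < t < b -> 2 / b * t ^+ 2 <= y ->
  b * (t ^+ i * y ^+ j) <= t ^+ i' * y ^+ j' ->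
  b * (t ^+ i' * y ^+ j') <= t ^+ i * y ^+ j ->
  exists2 q, (0 < q <= D)%N & b * t ^+ (q.*2).-1 <= y ^+ q.
Proof.
wlog jj' : i j i' j' / (j' <= j)%N.
  move=> H; case/orP: (leq_total j' j) => h; first exact: H.
  move=> neq jD j'D b01 tb ty h1 h2; apply: (H i' j' i j) => // -[? ?].
  by apply: neq; congr (_, _).
move=> neq jD j'D /andP[b0 b1] /andP[t0 tb] ty h1 h2.
have t1 : t <= 1 by apply: le_trans (ltW tb) b1.
have y0 : 0 < y by apply: lt_le_trans ty; rewrite mulr_gt0 ?divr_gt0 ?exprn_gt0.
have {h1}h1 : b * (t ^+ i * y ^+ (j - j')) <= t ^+ i'.
  rewrite -(ler_pM2r (exprn_gt0 j' y0)) -mulrA -mulrA -exprD.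
  by rewrite (_ : (j - j' + j')%N = j)//; lia.
have {h2}h2 : b * t ^+ i' <= t ^+ i * y ^+ (j - j').
  rewrite -(ler_pM2r (exprn_gt0 j' y0)) -mulrA -mulrA -exprD.
  by rewrite (_ : (j - j' + j')%N = j)//; lia.
have [jE|jlt] := eqVneq j j'.
  have ii' : i <> i' by move=> ii'; apply: neq; rewrite ii' jE.
  exfalso; move: h1 h2; rewrite jE subnn expr0 mulr1.
  have small k n : (k < n)%N -> b * t ^+ k <= t ^+ n -> False.
    move=> kn; rewrite -(subnK (ltnW kn)) exprD ler_pM2r ?exprn_gt0//.
    apply/negP; rewrite -ltNge; apply: le_lt_trans tb.
    rewrite -[leRHS]expr1; apply: ler_wiXn2l; [exact: ltW|by []|lia].
  have [/small h|/small h|//] := ltngtP i i'; [by move=> /h|by move=> _ /h].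
pose q := (j - j')%N; have q0 : (0 < q)%N by rewrite /q; lia.
exists q; first by rewrite q0 /q; lia.
rewrite -/q in h1 h2.
have [i'i|ii'] := leqP i' i.
  have : b * t ^+ i' <= t ^+ i' * y ^+ q.
    apply: le_trans h2 _; rewrite ler_wpM2r ?exprn_ge0 ?(ltW y0)//.
    by apply: ler_wiXn2l => //; exact: ltW.
  rewrite mulrC ler_pM2l ?exprn_gt0// => h; apply: le_trans h.
  by rewrite ler_piMr ?(ltW b0)// exprn_ile1// ltW.
have i'E : i' = ((i' - i) + i)%N by lia.
move: h1 h2; rewrite i'E exprD => h1 h2.
have {}h1 : b * y ^+ q <= t ^+ (i' - i).
  by rewrite -(ler_pM2r (exprn_gt0 i t0)); move: h1; congr (_ <= _); ring.
have {}h2 : b * t ^+ (i' - i) <= y ^+ q.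
  by rewrite -(ler_pM2r (exprn_gt0 i t0)); move: h2; congr (_ <= _); ring.
(* An exponent of at least 2q would give b (2/b)^q <= 1, while b (2/b)^q >= b (2/b) = 2. The factor
   2 in the lower bound on [y] is there for this contradiction. *)
have [Pq|Pq] := leqP q.*2 (i' - i).
  exfalso.
  have tq : t ^+ (i' - i) <= (t ^+ 2) ^+ q.
    by rewrite -exprM mul2n; apply: ler_wiXn2l => //; exact: ltW.
  have yq : (2 / b) ^+ q * (t ^+ 2) ^+ q <= y ^+ q.
    by rewrite -exprMn lerXn2r// ?nnegrE ?ltW// mulr_gt0 ?divr_gt0 ?exprn_gt0.
  have : b * ((2 / b) ^+ q * (t ^+ 2) ^+ q) <= 1 * (t ^+ 2) ^+ q.
    rewrite mul1r; apply: le_trans tq; apply: le_trans h1.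
    by rewrite ler_pM2l.
  rewrite mulrA ler_pM2r ?exprn_gt0//; apply/negP; rewrite -ltNge.
  have : b * (2 / b) <= b * (2 / b) ^+ q.
    rewrite ler_pM2l// -[leLHS]expr1 ler_weXn2l//.
    by rewrite ler_pdivlMr// mul1r; lra.
  by apply: lt_le_trans; rewrite mulrC divfK ?gt_eqF//; lra.
apply: le_trans h2; rewrite ler_pM2l//; apply: ler_wiXn2l => //; first exact: ltW.
lia.
Qed.

Lemma eval2E (D : nat) p t y : bideg D p ->
  eval2 p t y = \sum_(k : 'I_D.+1 * 'I_D.+1) p`_k.1`_k.2 * (t ^+ k.2 * y ^+ k.1).
Proof.
move=> [p1 p2]; rewrite /eval2 (horner_coef_wide _ p1) horner_sum.
rewrite -(pair_bigA _ (fun j i : 'I_D.+1 => p`_j`_i * (t ^+ i * y ^+ j)))/=.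
apply: eq_bigr => j _; rewrite -polyC_exp hornerM hornerC (horner_coef_wide _ (p2 j)).
by rewrite mulr_suml; apply: eq_bigr => i _; rewrite mulrA.
Qed.

(* Newton polygon: at a zero of [p] two distinct monomials of [p] have
   comparable size, which pins down the order of [y] as a power of [t]. *)
Lemma bivariate_root_growth (D : nat) p : p != 0 -> bideg D p ->
  exists2 b : R, 0 < b <= 1 & forall t y, 0 < t < b -> 2 / b * t ^+ 2 <= y ->
    eval2 p t y = 0 ->
    exists2 q, (0 < q <= D)%N & b * t ^+ (q.*2).-1 <= y ^+ q.
Proof.
move=> p0 pD; pose I := ('I_D.+1 * 'I_D.+1)%type.
pose a (k : I) : R := p`_k.1`_k.2.
have [k00 k00S] : exists k, a k != 0.
  have [p1 p2] := pD; pose j := (size p).-1.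
  have sj : (j < D.+1)%N by rewrite prednK ?size_poly_gt0//; lia.
  have pj0 : p`_j != 0 by rewrite -/(lead_coef p) lead_coef_eq0.
  pose i := (size (p`_j)).-1.
  have si : (i < D.+1)%N.
    by rewrite prednK ?size_poly_gt0//; have := p2 j; lia.
  by exists (Ordinal sj, Ordinal si); rewrite /a/= -/(lead_coef _) lead_coef_eq0.
pose mn := \big[Num.min/1]_(k | a k != 0) `|a k|.
pose M := 1 + \sum_k `|a k|.
have mn0 : 0 < mn.
  by apply: (big_ind (fun x => 0 < x)) => // [x y|k]; rewrite ?lt_min ?normr_gt0// => -> ->.
have mn_le k : a k != 0 -> mn <= `|a k| by move=> ak; exact: bigmin_le_cond.
have mn1 : mn <= 1 by exact: bigmin_le_id.
have M_ge k : `|a k| <= M.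
  rewrite /M (bigD1 k)//= addrCA lerDl addr_ge0// sumr_ge0//.
have M1 : 1 <= M by rewrite lerDl sumr_ge0.
have M0 : 0 < M by lra.
have N0 : (0 < #|{: I}|)%N by apply/card_gt0P; exists k00.
have N0' : 0 < #|{: I}|%:R :> R by rewrite ltr0n.
(* With N the number of index pairs, N M b = mn. If every other monomial with nonzero coefficient
   were below [b] times the largest one, the remaining N - 1 terms would sum to less than mn times
   the largest monomial, and could not cancel the leading term. *)
pose b := mn / (#|{: I}|%:R * M).
have b0 : 0 < b by rewrite divr_gt0 ?mulr_gt0.
have bE : #|{: I}|%:R * (M * b) = mn by rewrite mulrA /b mulrC divfK// gt_eqF// mulr_gt0.
have b1 : b <= 1.
  rewrite ler_pdivrMr ?mulr_gt0// mul1r (le_trans mn1)//.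
  by rewrite -[leLHS]mulr1 ler_pM// ler1n.
clearbody b; exists b; first by rewrite b0.
move=> t y tb ty; rewrite (eval2E _ _ pD) => pE0.
have t0 : 0 < t by case/andP: tb.
have y0 : 0 < y.
  by apply: lt_le_trans ty; apply: mulr_gt0; [exact: divr_gt0|exact: exprn_gt0].
pose mon (k : I) := t ^+ k.2 * y ^+ k.1.
have mon0 k : 0 < mon k by rewrite mulr_gt0// exprn_gt0.
case: (@arg_maxP _ R I k00 (fun k => a k != 0) mon k00S) => k0 k0S k0max.
have [k1 /and3P[k1k0 k1S k1b]] :
    exists k1, [&& k1 != k0, a k1 != 0 & b * mon k0 <= mon k1].
  apply/existsP; apply: contraT; rewrite negb_exists => /forallP h.
  suff : `|a k0| * mon k0 < `|a k0| * mon k0 by rewrite ltxx.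
  have {1}-> : `|a k0| * mon k0 = `|\sum_(k | k != k0) a k * mon k|.
    move: pE0; rewrite (bigD1 k0)//= => /eqP; rewrite addr_eq0 => /eqP E.
    rewrite -[in RHS]normrN; rewrite /a /mon in E *; rewrite -E normrM.
    by rewrite [X in _ = _ * X]gtr0_norm// mon0.
  apply: le_lt_trans (ler_norm_sum _ _ _) _.
  apply: (@le_lt_trans _ _ (\sum_(k | k != k0) M * b * mon k0)).
    apply: ler_sum => k kk0; rewrite normrM (gtr0_norm (mon0 k)).
    have := h k; rewrite kk0/= negb_and negbK -ltNge => /orP[/eqP->|hk].
      rewrite normr0 mul0r; apply: ltW; apply: mulr_gt0 (mon0 _); exact: mulr_gt0.
    rewrite -mulrA; apply: ler_pM => //; exact: ltW.
  rewrite sumr_const -mulrnAl; apply: lt_le_trans (_ : mn * mon k0 <= _); last first.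
    by rewrite ler_pM2r// mn_le.
  rewrite ltr_pM2r// -bE [ltRHS]mulr_natl ltr_pMn2l; last exact: mulr_gt0.
  by have := cardC1 k0; rewrite /predC1 => ->; rewrite ltn_predL.
have mon10 := k0max _ k1S.
apply: (@comparable_monomials D k0.2 k0.1 k1.2 k1.1 b) => //.
- move=> [e1 e2]; move/eqP: k1k0; apply.
  case: k0 k1 e1 e2 {k0S k0max k1S k1b mon10} => [? ?] [? ?] /= e1 e2.
  by congr (_, _); apply: val_inj.
- by rewrite -ltnS.
- by rewrite -ltnS.
- by rewrite b0.
- by apply: le_trans mon10; rewrite ler_piMl// ltW// mon0.
Qed.
End newton.

(** * Polynomial functions of several variables *)

Section polyfun.
Variables (R : realType) (m : nat).
Implicit Types (f g : 'cV[R]_m -> R).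

(** An inductive presentation, so that continuity, stability under directional derivatives and
    translation into first-order terms are structural inductions. *)
Inductive polyfun : ('cV[R]_m -> R) -> Prop :=
| polyfun_cst c : polyfun (fun=> c)
| polyfun_coord i : polyfun (fun x => x i 0)
| polyfun_add f g : polyfun f -> polyfun g -> polyfun (fun x => f x + g x)
| polyfun_mul f g : polyfun f -> polyfun g -> polyfun (fun x => f x * g x).

Lemma polyfun_sum (I : Type) (r : seq I) (F : I -> 'cV[R]_m -> R) :
  (forall i, polyfun (F i)) -> polyfun (fun x => \sum_(i <- r) F i x).
Proof.
move=> FP; elim: r => [|i r IH].
  by under [X in polyfun X]eq_fun do rewrite big_nil; exact: polyfun_cst.
by under [X in polyfun X]eq_fun do rewrite big_cons; exact: polyfun_add.
Qed.

Lemma polyfun_prod (I : Type) (r : seq I) (F : I -> 'cV[R]_m -> R) :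
  (forall i, polyfun (F i)) -> polyfun (fun x => \prod_(i <- r) F i x).
Proof.
move=> FP; elim: r => [|i r IH].
  by under [X in polyfun X]eq_fun do rewrite big_nil; exact: polyfun_cst.
by under [X in polyfun X]eq_fun do rewrite big_cons; exact: polyfun_mul.
Qed.

Lemma polyfun_exp f n : polyfun f -> polyfun (fun x => f x ^+ n).
Proof.
move=> fP; elim: n => [|n IH]; first exact: polyfun_cst.
by under [X in polyfun X]eq_fun do rewrite exprS; exact: polyfun_mul.
Qed.

Lemma polyfun_meval (p : mpoly.mpoly m R) :
  polyfun (fun x => mpoly.meval (fun j => x j 0) p).
Proof.
under [X in polyfun X]eq_fun do rewrite mpoly.mevalE.
apply: polyfun_sum => u; apply: polyfun_mul; first exact: polyfun_cst.
by apply: polyfun_prod => i; apply: polyfun_exp; exact: polyfun_coord.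
Qed.

Lemma polyfun_continuous f : polyfun f -> continuous f.
Proof.
elim=> [c|i|f1 f2 _ c1 _ c2|f1 f2 _ c1 _ c2] x.
- exact: cst_continuous.
- exact: coord_continuous.
- exact: continuousD (c1 x) (c2 x).
- exact: continuousM (c1 x) (c2 x).
Qed.

Lemma is_derive_coord (i : 'I_m) (x v : 'cV[R]_m) :
  is_derive x v (fun y : 'cV[R]_m => y i 0) (v i 0).
Proof.
have did : derivable (id : 'cV[R]_m -> 'cV[R]_m) x v by exact: derivable_id.
split; first by move/derivable_mxP : did; apply.
by have := derive_mx did; rewrite derive_id => /matrixP/(_ i 0); rewrite mxE => <-.
Qed.

Lemma polyfun_derive f v : polyfun f ->
  exists2 df, polyfun df & forall x, is_derive x v f (df x).
Proof.
elim=> [c|i|f1 f2 P1 [d1 p1 h1] P2 [d2 p2 h2]|f1 f2 P1 [d1 p1 h1] P2 [d2 p2 h2]].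
- by exists (fun=> 0); [exact: polyfun_cst|move=> x; exact: is_derive_cst].
- by exists (fun=> v i 0); [exact: polyfun_cst|move=> x; exact: is_derive_coord].
- exists (fun x => d1 x + d2 x); first exact: polyfun_add.
  by move=> x; exact: is_deriveD.
- exists (fun x => f1 x * d2 x + f2 x * d1 x).
    by apply: polyfun_add; exact: polyfun_mul.
  by move=> x; exact: is_deriveM.
Qed.

Lemma polyfun_sqnorm_grad f : polyfun f -> polyfun (fun x => dotv (grad f x) (grad f x)).
Proof.
move=> fP; apply: polyfun_sum => i.
have [df dfP fdf] := polyfun_derive (evec i) fP.
have -> : (fun x => grad f x i 0 * grad f x i 0) = (fun x => df x * df x).
  by apply/funext => x; rewrite mxE (@derive_val _ _ _ _ _ _ _ (fdf x)).
exact: polyfun_mul.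
Qed.

(** The first [k] variables are left free for parameters; the coordinates of [x] occupy the next [m]
    slots of the environment. *)
Lemma polyfun_term f : polyfun f -> forall k, exists2 u : GRing.term R,
  GRing.rterm u & forall e (x : 'cV[R]_m), size e = k ->
    GRing.eval (e ++ [seq x i 0 | i <- enum 'I_m]) u = f x.
Proof.
elim=> [c|i|f1 f2 _ h1 _ h2|f1 f2 _ h1 _ h2] k.
- by exists (GRing.Const c).
- exists (GRing.Var R (k + i)) => // e x ek /=.
  rewrite nth_cat ek ltnNge leq_addr/= addKn (nth_map i) ?nth_ord_enum//.
  by rewrite size_enum_ord.
- have [u1 r1 e1] := h1 k; have [u2 r2 e2] := h2 k.
  exists (GRing.Add u1 u2); first by rewrite /= r1.
  by move=> e x ek /=; rewrite e1// e2.
- have [u1 r1 e1] := h1 k; have [u2 r2 e2] := h2 k.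
  exists (GRing.Mul u1 u2); first by rewrite /= r1.
  by move=> e x ek /=; rewrite e1// e2.
Qed.

End polyfun.

(** * First-order definability of bounds for a polynomial function on a level set *)

Section definable.
Variable R : realType.
Local Notation formula := (ordered_qelim.ord.formula R).
Local Notation holds := (@ordered_qelim.ord.holds R).
Implicit Types (e s : seq R) (f : formula).

Definition exists_block (k n : nat) f : formula :=
  foldr (fun i h => ordered_qelim.ord.Exists i h) f (iota k n).

Lemma rformula_exists_block k n f :
  ordered_qelim.ord.rformula (exists_block k n f) = ordered_qelim.ord.rformula f.
Proof. by elim: n k => // n IH k; exact: IH. Qed.

(** The block starts at index [size e], so each quantifier writes just past the end of the
    environment and thus appends its value. *)
Lemma holds_exists_block n e f : holds e (exists_block (size e) n f) <->
  exists2 s, size s = n & holds (e ++ s) f.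
Proof.
elim: n e => [|n IH] e.
  by split=> [h|[s /size0nil->]]; [exists [::]|]; rewrite ?cats0.
have E y : set_nth 0 e (size e) y = rcons e y by rewrite set_nthE ltnn subnn -cats1.
have IH' y : holds (rcons e y) (exists_block (size e).+1 n f) <->
    exists2 s, size s = n & holds (rcons e y ++ s) f.
  by have := IH (rcons e y); rewrite size_rcons.
split.
  move=> [y]; rewrite E => /IH'[s sn h].
  by exists (y :: s); rewrite -?cat_rcons//= sn.
move=> [[//|y s] [sn] h]; exists y; rewrite E; apply/IH'.
by exists s => //; rewrite cat_rcons.
Qed.

Definition and_block (n : nat) (F : 'I_n -> formula) f : formula :=
  foldr (fun i h => ordered_qelim.ord.And (F i) h) f (enum 'I_n).

Lemma rformula_and_block n (F : 'I_n -> formula) f :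
  (forall i, ordered_qelim.ord.rformula (F i)) ->
  ordered_qelim.ord.rformula f -> ordered_qelim.ord.rformula (and_block F f).
Proof.
by rewrite /and_block => rF rf; elim: (enum _) => //= i r ->; rewrite rF.
Qed.

Lemma holds_and_block e n (F : 'I_n -> formula) f :
  holds e (and_block F f) <-> (forall i, holds e (F i)) /\ holds e f.
Proof.
rewrite /and_block.
have -> : (forall i, holds e (F i)) = (forall i, i \in enum 'I_n -> holds e (F i)).
  by apply/propext; split=> h i //; apply: h; rewrite mem_enum.
elim: (enum _) => [|i r IH] /=; first by split=> [h|[]].
rewrite IH; split=> [[h1 [h2 h3]]|[h1 h2]].
  by split=> // j; rewrite inE => /orP[/eqP->//|/h2].
by split; [apply: h1; rewrite mem_head|split=> // j jr; apply: h1; rewrite inE jr orbT].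
Qed.

(* Quantifier elimination for the formula
   [exists x, (forall i, (x i - x0 i)^2 <= r^2) /\ (f x - c)^2 = t^2 /\ g x <= y]
   in the variables [t :: y :: c :: r :: x0 ++ x]. *)
Lemma polyfun_fiber_varying (m : nat) (f g : 'cV[R]_m -> R) :
  polyfun f -> polyfun g -> exists D, forall (x0 : 'cV[R]_m) (c r : R),
    exists (p : {poly {poly R}}) (a : R -> R -> bool), [/\ p != 0, bideg D p,
      forall t y, a t y <-> exists x : 'cV[R]_m,
        [/\ forall i, (x i 0 - x0 i 0) ^+ 2 <= r ^+ 2,
            (f x - c) ^+ 2 = t ^+ 2 & g x <= y] &
      forall t y, eval2 p t y != 0 -> exists2 eps : R, 0 < eps &
        forall y', `|y' - y| < eps -> a t y' = a t y].
Proof.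
move=> fP gP.
have [uf rf ufE] := polyfun_term fP (4 + m).
have [ug rg ugE] := polyfun_term gP (4 + m).
pose X i : GRing.term R := GRing.Var R i.
pose box (i : 'I_m) : formula := ordered_qelim.ord.Le
  (GRing.Exp (GRing.Add (X (4 + m + i)%N) (GRing.Opp (X (4 + i)%N))) 2)
  (GRing.Exp (X 3%N) 2).
pose body := ordered_qelim.ord.And (ordered_qelim.ord.Equal
    (GRing.Exp (GRing.Add uf (GRing.Opp (X 2%N))) 2) (GRing.Exp (X 0%N) 2))
  (ordered_qelim.ord.Le ug (X 1%N)).
pose phi := exists_block (4 + m) m (and_block box body).
have rphi : ordered_qelim.ord.rformula phi.
  rewrite rformula_exists_block; apply: rformula_and_block => //.
  by rewrite /= rf rg.
have [h /andP[qh rh] hE] := rcf_quantifier_elim rphi.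
(* The formula is fixed, and [x0], [c], [r] occur only as values of its variables; hence [D] is
   available before they are introduced. *)
have [D hD] := qf_algebraically_varying qh rh.
exists D => x0 c r; pose e := [:: c, r & [seq x0 i 0 | i <- enum 'I_m]].
have [p [p0 pD pE]] := hD e; exists p, (fun t y => ordered_qelim.ord.qf_eval [:: t, y & e] h).
split=> // t y.
have se : size [:: t, y & e] = (4 + m)%N by rewrite /= size_map size_enum_ord.
apply: iff_trans (iff_sym (hE _)) _.
rewrite /phi -{1}se; apply: iff_trans (holds_exists_block _ _ _) _.
have bodyE (x : 'cV[R]_m) :
    holds ([:: t, y & e] ++ [seq x i 0 | i <- enum 'I_m]) (and_block box body) <->
    [/\ forall i, (x i 0 - x0 i 0) ^+ 2 <= r ^+ 2,
        (f x - c) ^+ 2 = t ^+ 2 & g x <= y].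
  rewrite holds_and_block.
  have boxE i : holds ([:: t, y & e] ++ [seq x i 0 | i <- enum 'I_m]) (box i) <->
      (x i 0 - x0 i 0) ^+ 2 <= r ^+ 2.
    rewrite /box; cbn [ordered_qelim.ord.holds GRing.eval X].
    rewrite nth_cat se ltnNge leq_addr/= addKn (nth_map i) ?nth_ord_enum ?size_enum_ord//.
    rewrite add0n nth_cat size_map size_enum_ord ltn_ord.
    by rewrite (nth_map i) ?nth_ord_enum ?size_enum_ord.
  split.
    move=> [hb [h1 h2]]; split; first by move=> i; apply/boxE.
      by move: h1; cbn [ordered_qelim.ord.holds GRing.eval X]; rewrite ufE.
    by move: h2; cbn [ordered_qelim.ord.holds GRing.eval X]; rewrite ugE.
  move=> [hb h1 h2]; split; first by move=> i; apply/boxE.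
  by split; cbn [ordered_qelim.ord.holds GRing.eval X]; rewrite ?ufE ?ugE.
split=> [[s sm]|[x xP]].
  have -> : s = [seq (\col_i s`_i : 'cV[R]_m) i 0 | i <- enum 'I_m].
    apply: (@eq_from_nth _ 0); first by rewrite size_map size_enum_ord.
    move=> i; rewrite sm => im; rewrite (nth_map (Ordinal im)) ?size_enum_ord// mxE.
    by rewrite nth_enum_ord.
  by move/bodyE => hx; eexists; exact: hx.
exists [seq x i 0 | i <- enum 'I_m]; first by rewrite size_map size_enum_ord.
exact/bodyE.
Qed.

End definable.

(** * A Lojasiewicz exponent uniform over all base points *)

Section uniform.
Variable R : realType.

Lemma dotv_ge0 n (u : 'cV[R]_n) : 0 <= dotv u u.
Proof. by apply: sumr_ge0 => i _; rewrite -expr2 sqr_ge0. Qed.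

Lemma enorm_ge0 n (u : 'cV[R]_n) : 0 <= enorm u.
Proof. exact: sqrtr_ge0. Qed.

Lemma sqr_enorm n (u : 'cV[R]_n) : enorm u ^+ 2 = dotv u u.
Proof. by rewrite sqr_sqrtr// dotv_ge0. Qed.

Lemma powR_small (nu K : R) : 0 < nu -> 0 < K ->
  exists2 eta : R, 0 < eta & forall t, 0 <= t <= eta -> t `^ nu <= K.
Proof.
move=> nu0 K0; exists (K `^ nu^-1); first exact: powR_gt0.
move=> t /andP[t0 tK]; have -> : K = (K `^ nu^-1) `^ nu.
  by rewrite -powRrM mulVf ?gt_eqF// powRr1// ltW.
by apply: ge0_ler_powR => //; rewrite ?nnegrE// ?powR_ge0// ltW.
Qed.

(** This is the root of order 2q of the hypothesis: it yields the exponent 1 - 1/(2q), which may be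
    raised to 1 - 1/(2D) because t <= 1 and q <= D. The constant survives because b^(2q) <= b. *)
Lemma powR_exponent_bound (D q : nat) (b t n : R) : (0 < q <= D)%N ->
  0 < b <= 1 -> 0 < t <= 1 -> 0 <= n -> b * t ^+ (q.*2).-1 <= n ^+ q.*2 ->
  t `^ (1 - (D.*2)%:R^-1) <= b^-1 * n.
Proof.
move=> /andP[q0 qD] /andP[b0 b1] /andP[t0 t1] n0 H.
have D0 : 0 < D%:R :> R by rewrite ltr0n; lia.
have t00 := ltW t0.
rewrite leNgt; apply/negP; rewrite mulrC ltr_pdivrMr// => nb.
set th := (1 - _) in nb; suff : n ^+ q.*2 < b * t ^+ (q.*2).-1 by rewrite ltNge H.
have q20 : (0 < q.*2)%N by rewrite double_gt0.
apply: (@lt_le_trans _ _ ((t `^ th * b) ^+ q.*2)).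
  by rewrite (ltrXn2r _ n0 nb) -lt0n.
rewrite exprMn mulrC ler_pM ?exprn_ge0 ?powR_ge0 ?(ltW b0)//.
  by rewrite -[leRHS]expr1; apply: ler_wiXn2l => //; exact: ltW.
rewrite -[leLHS]powR_mulrn ?powR_ge0// -powRrM -[leRHS]powR_mulrn//.
apply: ger_powR; first by rewrite t0.
rewrite /th mulrBl mul1r.
have -> : ((q.*2).-1)%:R = (q.*2)%:R - 1 :> R.
  by rewrite -subn1 natrB.
rewrite lerD2l lerN2 mulrC ler_pdivrMr ?ltr0n ?double_gt0; last by lia.
by rewrite mul1r ler_nat leq_double.
Qed.

Lemma polyfun_uniform_lojasiewicz (m : nat) (f : 'cV[R]_m -> R) : polyfun f ->
  exists2 D, (0 < D)%N & forall x0, lojasiewicz_at f x0 ->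
    exists2 C : R, 0 < C & \forall x \near x0,
      `|f x - f x0| `^ (1 - (D.*2)%:R^-1) <= C * enorm (grad f x).
Proof.
move=> fP; pose G x := dotv (grad f x) (grad f x).
have GP : polyfun G := polyfun_sqnorm_grad fP.
have [D0 hD] := polyfun_fiber_varying fP GP.
exists D0.+1 => // x0 [mu [/andP[mu0 mu1] [C [C0 /nbhs_ballP[r0 /= r00 loj]]]]].
pose c := f x0; pose r := r0 / 2; have r_gt0 : 0 < r by rewrite divr_gt0.
have [p [a [p0 pD aE aloc]]] := hD x0 c r.
have [b b01 pgrowth] := bivariate_root_growth p0 pD.
have /andP[b0 b1] := b01.
(* Once t^(1 - mu) <= K, squaring t^mu <= C |grad f| and multiplying by t^(2 (1 - mu)) <= b / (2
   C^2) gives (2/b) t^2 <= |grad f|^2, the lower bound required by [bivariate_root_growth]. The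
   minimum with 1 lets [K] bound the square of t^(1 - mu) as well. *)
pose K := Num.min 1 (b / (2 * C ^+ 2)).
have K0 : 0 < K by rewrite lt_min ltr01 divr_gt0 ?mulr_gt0 ?exprn_gt0.
have numu : 0 < 1 - mu by lra.
have [eta eta0 etaP] := powR_small numu K0.
exists b^-1; first by rewrite invr_gt0.
have /cvgrPdist_lt cf : f x @[x --> x0] --> f x0 by exact: polyfun_continuous fP x0.
have me : 0 < Num.min eta b by rewrite lt_min eta0.
near=> x.
have xt : `|f x - c| < Num.min eta b.
  by rewrite distrC; near: x; exact: cf.
have xr : ball x0 r x by near: x; exact: nbhsx_ballx.
have [->|tn0] := eqVneq (f x - c) 0.
  rewrite normr0 powR0.
    by rewrite mulr_ge0 ?enorm_ge0// invr_ge0 ltW.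
  rewrite gt_eqF// subr_gt0 invf_lt1 ?ltr0n ?double_gt0// ltr1n.
  by rewrite doubleS.
pose t := `|f x - c|; have t0 : 0 < t by rewrite normr_gt0.
move: xt; rewrite lt_min -/t => /andP[teta tb].
have boxball (z : 'cV[R]_m) : (forall i, (z i 0 - x0 i 0) ^+ 2 <= r ^+ 2) -> ball x0 r0 z.
  move=> zr; split=> // i j; rewrite ord1 /ball/= distrC.
  rewrite -ltr_sqr ?nnegrE ?(ltW r00)// real_normK ?num_real//.
  apply: le_lt_trans (zr i) _; rewrite ltr_sqr ?nnegrE ?(ltW r_gt0) ?(ltW r00)//.
  by rewrite /r; lra.
have alow y : a t y -> 2 / b * t ^+ 2 <= y.
  move=> /aE[z [/boxball zb zt Gzy]]; apply: le_trans Gzy.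
  have {}zt : `|f z - f x0| = t.
    apply/eqP; rewrite -(@eqrXn2 _ 2) ?(ltW t0)// real_normK ?num_real//.
    by rewrite zt.
  have := loj z zb; rewrite zt => lz.
  have tE : t = t `^ mu * t `^ (1 - mu).
    rewrite -powRD; last by rewrite (gt_eqF t0) implybT.
    by rewrite addrCA subrr addr0 powRr1 ?ltW.
  have tK : t `^ (1 - mu) <= K by apply: etaP; rewrite !ltW.
  have K2 : (t `^ (1 - mu)) ^+ 2 <= b / (2 * C ^+ 2).
    apply: (@le_trans _ _ K); last by rewrite ge_min lexx orbT.
    apply: (@le_trans _ _ (K * 1)); last by rewrite mulr1.
    rewrite expr2 ler_pM ?powR_ge0//.
    by apply: le_trans tK _; rewrite ge_min lexx.
  have t2 : t ^+ 2 <= C ^+ 2 * G z * (b / (2 * C ^+ 2)).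
    rewrite tE exprMn ler_pM ?sqr_ge0//.
    rewrite /G -sqr_enorm -exprMn; apply: lerXn2r => //; rewrite nnegrE ?powR_ge0//.
    by rewrite mulr_ge0 ?enorm_ge0// ltW.
  have : 2 / b * t ^+ 2 <= 2 / b * (C ^+ 2 * G z * (b / (2 * C ^+ 2))).
    by rewrite ler_pM2l// divr_gt0.
  by congr (_ <= _); field; rewrite !gt_eqF.
have aup y y' : a t y -> y <= y' -> a t y'.
  by move=> /aE[z [h1 h2 h3]] yy'; apply/aE; exists z; split=> //; exact: le_trans yy'.
have ax : a t (G x).
  apply/aE; exists x; split=> //; last by rewrite /t real_normK// num_real.
  move=> i; move: xr => [_ /(_ i 0)]; rewrite /ball/= distrC => /ltW xr.
  rewrite -[leLHS]real_normK ?num_real//; apply: lerXn2r => //; rewrite nnegrE//.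
  exact: ltW.
pose Y := [set y | a t y]; pose y0 := inf Y.
have Ylb : has_lbound Y by exists (2 / b * t ^+ 2) => y; exact: alow.
have Yinf : has_inf Y by split=> //; exists (G x).
have y0G : y0 <= G x by exact: ge_inf.
have y0low : 2 / b * t ^+ 2 <= y0.
  by apply: lb_le_inf; [exists (G x)|move=> y; exact: alow].
(* If [p] did not vanish at (t, y0), the truth value of [a t] would be constant around [y0]. It
   holds at points arbitrarily close to the infimum, so it would hold also at y0 - eps/2, below the
   infimum. *)
have py0 : eval2 p t y0 = 0.
  apply/eqP; apply: contraT => /aloc[eps eps0 loc].
  have [y Yy yeps] := inf_adherent eps0 Yinf.
  have ay0 : a t y0.
    rewrite -(loc y) => //; rewrite ger0_norm ?subr_ge0; last exact: ge_inf.
    by rewrite ltrBlDl.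
  have : a t (y0 - eps / 2).
    rewrite loc//; rewrite addrAC subrr sub0r normrN gtr0_norm ?divr_gt0//; lra.
  by move=> /(ge_inf Ylb); rewrite -/y0; lra.
have tb' : 0 < t < b by rewrite t0.
have [q qD tq] := pgrowth t y0 tb' y0low py0.
apply: (@powR_exponent_bound _ q) => //.
- by move: qD => /andP[-> qD]; rewrite /= leqW.
- by rewrite t0 (le_trans (ltW tb)).
- exact: enorm_ge0.
- rewrite -/t; apply: le_trans tq _; rewrite -mul2n exprM sqr_enorm.
  apply: lerXn2r => //; rewrite nnegrE ?dotv_ge0//.
  by apply: le_trans y0low; rewrite mulr_ge0 ?sqr_ge0 ?divr_ge0// ltW.
Unshelve. all: by end_near.
Qed.
End uniform.

(** * Spectral theory of symmetric matrices *)

Section symmetric.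
Variables (R : realType) (m : nat).
Implicit Types (A : 'M[R]_m) (u v w : 'cV[R]_m) (l : R).

(** Over the complex numbers [A] is Hermitian, hence unitarily similar to a real diagonal matrix;
    real matrices that are similar over the complex numbers are similar over the reals. The
    resulting [P] is merely invertible, and its rows are eigenvectors. *)
Lemma symmetric_diagonalization A : A^T = A ->
  exists (P : 'M[R]_m) (d : 'rV[R]_m),
    P \in unitmx /\ P *m A = diag_mx d *m P.
Proof.
move=> Asym; pose f := (complex.real_complex R); pose AC := map_mx f A.
have fE (x : R) : complex.Re (f x) = x by [].
have AC_real : AC \is a mxOver Num.real.
  by apply/mxOverP => i j; rewrite mxE; apply/complex.complex_realP; exists (A i j).
have AC_herm : AC \is sesquilinear.hermsymmx.
  apply: spectral.realsym_hermsym => //; apply/sesquilinear.is_hermitianmxP.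
  by rewrite expr0 scale1r map_mx_id// /AC map_trmx Asym.
have /spectral.orthomx_spectralP ACE := spectral.hermitian_normalmx AC_herm.
have sp_real := spectral.hermitian_spectral_diag_real AC_herm.
set sp := spectral.spectral_diag AC in ACE sp_real.
set U := spectral.spectralmx AC in ACE.
have Uu : U \in unitmx by exact: spectral.spectral_unit.
have /spectral.real_similar : exists2 P, P \in unitmx & mxred.similar_to P AC (pred1 (diag_mx sp)).
  exists U => //; apply/mxred.similarP => //.
  by rewrite {1}ACE -!mulmxA mulKVmx.
have dsp_real : diag_mx sp \is a mxOver Num.real.
  apply/mxOverP => i j; rewrite !mxE; case: (i == j); last by rewrite mulr0n real0.
  by rewrite mulr1n; exact: (mxOverP sp_real).
move=> /(_ AC_real dsp_real)[Q /= /andP[Q_real Qu]] /(mxred.similarP Qu) QE.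
have ReK n k (B : 'M[complex.complex R]_(n, k)) : B \is a mxOver Num.real ->
    map_mx f (map_mx (@complex.Re R) B) = B.
  by move=> /mxOverP BR; apply/matrixP => i j; rewrite !mxE; exact: complex.RRe_real.
exists (map_mx (@complex.Re R) Q), (map_mx (@complex.Re R) sp); split.
  by rewrite -(map_unitmx f) ReK.
apply: (@map_mx_inj _ _ f); rewrite !map_mxM map_diag_mx !ReK//.
Qed.

End symmetric.

(** * Eigenvector expansions and the search direction *)

Section spectral_direction.
Variables (R : realType) (m : nat).
Implicit Types (A : 'M[R]_m) (u v w g : 'cV[R]_m) (l : R).

Lemma dotvE n (u v : 'cV[R]_n) : dotv u v = (u^T *m v) 0 0.
Proof. by rewrite mxE; apply: eq_bigr => i _; rewrite mxE. Qed.

Lemma dotvC n (u v : 'cV[R]_n) : dotv u v = dotv v u.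
Proof. by apply: eq_bigr => i _; rewrite mulrC. Qed.

Lemma dotvDl n (u v w : 'cV[R]_n) : dotv (u + v) w = dotv u w + dotv v w.
Proof. by rewrite !dotvE linearD mulmxDl mxE. Qed.

Lemma dotvZl n (a : R) (u v : 'cV[R]_n) : dotv (a *: u) v = a * dotv u v.
Proof. by rewrite !dotvE linearZ -scalemxAl mxE. Qed.

Lemma dotvBl n (u v w : 'cV[R]_n) : dotv (u - v) w = dotv u w - dotv v w.
Proof. by rewrite -scaleN1r dotvDl dotvZl mulN1r. Qed.

Lemma dotvZr n (a : R) (u v : 'cV[R]_n) : dotv u (a *: v) = a * dotv u v.
Proof. by rewrite dotvC dotvZl dotvC. Qed.

Lemma dotvBr n (u v w : 'cV[R]_n) : dotv w (u - v) = dotv w u - dotv w v.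
Proof. by rewrite dotvC dotvBl !(dotvC w). Qed.

Lemma dotv0l n (u : 'cV[R]_n) : dotv 0 u = 0.
Proof. by rewrite dotvE trmx0 mul0mx mxE. Qed.

Lemma dotv_suml n (I : Type) (r : seq I) (P : pred I) (F : I -> 'cV[R]_n) (v : 'cV[R]_n) :
  dotv (\sum_(i <- r | P i) F i) v = \sum_(i <- r | P i) dotv (F i) v.
Proof.
elim/big_rec2: _ => [|i y x _ <-]; first exact: dotv0l.
exact: dotvDl.
Qed.

Lemma dotv_sumr n (I : Type) (r : seq I) (P : pred I) (F : I -> 'cV[R]_n) (v : 'cV[R]_n) :
  dotv v (\sum_(i <- r | P i) F i) = \sum_(i <- r | P i) dotv v (F i).
Proof. by rewrite dotvC dotv_suml; apply: eq_bigr => i _; rewrite dotvC. Qed.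

Lemma dotv_eq0 n (u : 'cV[R]_n) : (dotv u u == 0) = (u == 0).
Proof.
apply/idP/eqP => [|->]; last by rewrite dotv0l.
rewrite psumr_eq0 => [/allP h|i _]; last by rewrite -expr2 sqr_ge0.
apply/matrixP => i j; rewrite ord1 mxE; apply/eqP.
by have := h i; rewrite mem_index_enum => /(_ isT)/=; rewrite mulf_eq0 orbb.
Qed.

Lemma enorm_eq0 n (u : 'cV[R]_n) : (enorm u == 0) = (u == 0).
Proof. by rewrite -sqrf_eq0 sqr_enorm dotv_eq0. Qed.

Lemma enormZ n (a : R) (u : 'cV[R]_n) : enorm (a *: u) = `|a| * enorm u.
Proof.
by rewrite /enorm dotvZl dotvZr mulrA -expr2 sqrtrM ?sqr_ge0// sqrtr_sqr.
Qed.

Lemma eigenvectors_orthogonal A u v l k : A^T = A ->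
  A *m u = l *: u -> A *m v = k *: v -> l != k -> dotv u v = 0.
Proof.
move=> Asym Au Av lk; apply/eqP; rewrite -(mulrI_eq0 _ (mulfI (x := l - k) _)) ?subr_eq0//.
rewrite mulrBl -dotvZl -dotvZr -Au -Av !dotvE trmx_mul Asym mulmxA subrr//.
Qed.

Lemma eigenvalue_col A u l : A^T = A -> A *m u = l *: u -> u != 0 -> eigenvalue A l.
Proof.
move=> Asym Au u0; apply/eigenvalueP; exists u^T; last by rewrite trmx_eq0.
by rewrite -[in LHS]Asym -trmx_mul Au linearZ.
Qed.

Lemma eigen_decomposition A g : A^T = A ->
  exists (s : seq R) (G : R -> 'cV[R]_m),
    [/\ uniq s, forall l, A *m G l = l *: G l & g = \sum_(l <- s) G l].
Proof.
move=> Asym; have [P [d [Pu PA]]] := symmetric_diagonalization Asym.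
pose c := g^T *m invmx P; pose h i := c 0 i *: (row i P)^T.
exists (undup [seq d 0 i | i <- enum 'I_m]), (fun l => \sum_(i | d 0 i == l) h i).
split; first exact: undup_uniq.
  move=> l; rewrite mulmx_sumr scaler_sumr; apply: eq_bigr => i /eqP <-.
  rewrite /h -scalemxAr scalerA mulrC -scalerA; congr (_ *: _).
  rewrite -[in LHS]Asym -trmx_mul -row_mul PA row_mul.
  by rewrite row_diag_mx -scalemxAl -rowE linearZ.
have -> : g = \sum_i h i.
  have -> : g = (c *m P)^T by rewrite mulmxKV// trmxK.
  rewrite mulmx_sum_row linear_sum; apply: eq_bigr => i _.
  by rewrite linearZ.
under [RHS]eq_bigr do rewrite big_mkcond.
rewrite exchange_big/=; apply: eq_bigr => i _; rewrite -big_mkcond/=.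
rewrite (eq_bigl (pred1 (d 0 i))); last by move=> l; rewrite /= eq_sym.
rewrite -big_filter filter_pred1_uniq ?undup_uniq ?big_seq1//.
by rewrite mem_undup; apply/mapP; exists i => //; rewrite mem_enum.
Qed.

Lemma dotv_eigen_sum A (s : seq R) (G : R -> 'cV[R]_m) (a b : R -> R) :
  A^T = A -> uniq s -> (forall l, A *m G l = l *: G l) ->
  dotv (\sum_(l <- s) a l *: G l) (\sum_(l <- s) b l *: G l) =
  \sum_(l <- s) a l * b l * dotv (G l) (G l).
Proof.
move=> Asym us AG; rewrite dotv_suml [LHS]big_seq_cond [RHS]big_seq_cond.
apply: eq_bigr => l /andP[ls _].
rewrite dotv_sumr (bigD1_seq l)//= big1_seq ?addr0 => [|k /andP[kl _]].
  by rewrite dotvZl dotvZr mulrA.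
rewrite dotvZl dotvZr (eigenvectors_orthogonal Asym (AG l) (AG k)) ?mulr0//.
by rewrite eq_sym.
Qed.

Lemma unitmx_eigenvalue0 A : ~~ eigenvalue A 0 -> A \in unitmx.
Proof.
rewrite -row_free_unit -kermx_eq0 /eigenvalue /eigenspace negbK.
by rewrite (_ : 0%:M = 0) ?subr0//; apply/matrixP => i j; rewrite !mxE mul0rn.
Qed.

Lemma orth_proj_unique (S : 'cV[R]_m -> Prop) v p p' :
  orth_proj S v p -> orth_proj S v p' -> p = p'.
Proof.
move=> [Sp hp] [Sp' hp']; apply/eqP; rewrite -subr_eq0 -dotv_eq0.
have h u : S u -> dotv (p - p') u = 0.
  move=> Su; have -> : p - p' = (v - p') - (v - p).
    by apply/matrixP => i j; rewrite !mxE; ring.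
  by rewrite dotvBl hp// hp'// subrr.
by rewrite dotvBr !h// subrr.
Qed.

Lemma eigen_sum_orth_proj A (s : seq R) (G : R -> 'cV[R]_m) (a : R -> R) (Q : pred R) l0 :
  A^T = A -> (forall l, A *m G l = l *: G l) -> Q l0 ->
  orth_proj (eig_span A (fun l => Q l)) (\sum_(l <- s) a l *: G l)
    (\sum_(l <- s | Q l) a l *: G l).
Proof.
move=> Asym AG Ql0; split.
  (* The positions where [Q] fails are filled with the zero vector, which satisfies the eigenvector
     equation for [l0]. *)
  exists (size s), (fun i => a s`_i), (fun i => if Q s`_i then G s`_i else 0).
  split=> [i|].
    case: ifPn => Qi; first by exists s`_i.
    by exists l0; rewrite mulmx0 scaler0.
  rewrite (big_nth 0) big_mkord big_mkcond; apply: eq_bigr => i _.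
  by case: ifP => //; rewrite scaler0.
move=> u [k [c [e [he ->]]]].
rewrite [X in X - _](bigID Q)/= addrAC subrr add0r dotv_suml big1// => l Ql.
rewrite dotv_sumr big1// => i _; have [l' [Ql' Ae]] := he i.
rewrite dotvZl dotvZr (eigenvectors_orthogonal Asym (AG l) Ae) ?mulr0//.
by apply: contraNneq Ql => ->.
Qed.

(* In an eigenbasis of [A] the vector [p - q] is [|A|^-1 g]. *)
Lemma newton_direction A g v p q (sigma M : R) : A^T = A -> 0 < sigma ->
  (forall l, eigenvalue A l -> sigma <= `|l| <= M) -> v = invmx A *m g ->
  orth_proj (eig_span A (fun l => 0 < l)) v p ->
  orth_proj (eig_span A (fun l => l < 0)) v q ->
  sigma * enorm (p - q) ^+ 2 <= dotv (p - q) g /\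
  enorm g ^+ 2 <= M * dotv (p - q) g.
Proof.
move=> Asym s0 hA vE hp hq; have [s [G [us AG gE]]] := eigen_decomposition g Asym.
have GA l : G l != 0 -> sigma <= `|l| <= M.
  by move=> Gl; apply: hA; exact: eigenvalue_col (AG l) Gl.
have Au : A \in unitmx.
  apply: unitmx_eigenvalue0; apply/negP => /hA; rewrite normr0 => /andP[]; lra.
have vE' : v = \sum_(l <- s) l^-1 *: G l.
  rewrite vE; apply: (can_inj (mulKmx Au)); rewrite mulKVmx// mulmx_sumr.
  rewrite [in LHS]gE; apply: eq_bigr => l _; rewrite -scalemxAr AG scalerA.
  have [->|Gl] := eqVneq (G l) 0; first by rewrite scaler0.
  rewrite mulVf ?scale1r// -normr_gt0; apply: lt_le_trans s0 _.
  by case/andP: (GA l Gl).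
have pE : p = \sum_(l <- s | 0 < l) l^-1 *: G l.
  apply: orth_proj_unique hp _; rewrite vE'.
  exact: (@eigen_sum_orth_proj A s G GRing.inv (fun l => 0 < l) 1).
have qE : q = \sum_(l <- s | l < 0) l^-1 *: G l.
  apply: orth_proj_unique hq _; rewrite vE'.
  by apply: (@eigen_sum_orth_proj A s G GRing.inv (fun l => l < 0) (-1)) => //; rewrite ltrN10.
(* Subtracting the negative part turns the inverse of [l] into that of its absolute value; at l = 0
   both sides vanish, the inverse of 0 being 0. *)
have wE : p - q = \sum_(l <- s) `|l|^-1 *: G l.
  rewrite pE qE big_mkcond [X in _ - X]big_mkcond -sumrB; apply: eq_bigr => l _.
  have [l0|l0|<-] := ltgtP 0 l.
  - by rewrite subr0 gtr0_norm.
  - by rewrite sub0r ltr0_norm// invrN scaleNr.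
  - by rewrite normr0 invr0 scale0r subr0.
have gE' : g = \sum_(l <- s) 1 *: G l by rewrite gE; apply: eq_bigr => l _; rewrite scale1r.
have wg := dotv_eigen_sum (fun l => `|l|^-1) (fun=> 1) Asym us AG.
have ww := dotv_eigen_sum (fun l => `|l|^-1) (fun l => `|l|^-1) Asym us AG.
have gg := dotv_eigen_sum (fun=> 1) (fun=> 1) Asym us AG.
rewrite !sqr_enorm wE gE' wg ww gg !mulr_sumr; split; apply: ler_sum => l _.
- have [->|/GA/andP[sl lM]] := eqVneq (G l) 0; first by rewrite dotv0l !mulr0.
  have l0 : 0 < `|l| by exact: lt_le_trans sl.
  rewrite mulrA ler_wpM2r ?dotv_ge0// mulr1 mulrA ger_pMl ?invr_gt0//.
  by rewrite ler_pdivrMr// mul1r.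
- have [->|/GA/andP[sl lM]] := eqVneq (G l) 0; first by rewrite dotv0l !mulr0.
  have l0 : 0 < `|l| by exact: lt_le_trans sl.
  by rewrite mulrA ler_wpM2r ?dotv_ge0// !mulr1 ler_pdivlMr// mul1r.
Qed.

(** Compare the sums of absolute values of the entries on the two sides of v A = l v. *)
Lemma eigenvalue_le_sum A l : eigenvalue A l -> `|l| <= \sum_i \sum_j `|A i j|.
Proof.
move=> /eigenvalueP[v vA v0]; pose S := \sum_i `|v 0 i|.
have vS i : `|v 0 i| <= S by rewrite /S (bigD1 i)//= lerDl sumr_ge0.
have S0 : 0 < S.
  have [i vi] : exists i, v 0 i != 0.
    by apply/existsP; apply: contraNT v0; rewrite negb_exists => /forallP h;
      apply/eqP/rowP => i; rewrite mxE; apply/eqP; rewrite -[_ == _]negbK.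
  by apply: lt_le_trans (vS i); rewrite normr_gt0.
rewrite -(ler_pM2l S0) {1}/S mulr_suml [leRHS]mulr_sumr.
under [leRHS]eq_bigr do rewrite mulr_sumr.
rewrite [leRHS]exchange_big; apply: ler_sum => j _.
have -> : `|v 0 j| * `|l| = `|\sum_i v 0 i * A i j|.
  by rewrite -normrM mulrC; have /rowP/(_ j) := vA; rewrite !mxE => <-.
apply: le_trans (ler_norm_sum _ _ _) _; apply: ler_sum => i _.
by rewrite normrM ler_wpM2r.
Qed.

Lemma minsp_le A l : eigenvalue A l -> minsp A <= `|l|.
Proof.
move=> Al; apply: ge_inf; last by exists l.
by exists 0 => _ [k _ <-].
Qed.

Lemma eigenvalue_shift A c l : eigenvalue (A + c%:M) l -> eigenvalue A (l - c).
Proof.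
move=> /eigenvalueP[v vA v0]; apply/eigenvalueP; exists v => //.
by apply/eqP; rewrite scalerBl -vA mulmxDr mul_mx_scalar addrK.
Qed.

End spectral_direction.

(** * Functions with continuous partial derivatives *)

Section calculus.
Variables (R : realType) (m : nat).
Implicit Types (f g : 'cV[R]_m -> R) (x v h : 'cV[R]_m).

Lemma is_derive_line g x v (t dg : R) : is_derive (x + t *: v) v g dg ->
  is_derive t 1 (fun s : R => g (x + s *: v)) dg.
Proof.
move=> [gd gE].
have E : (fun h : R => h^-1 *: (((fun s : R => g (x + s *: v)) \o shift t) (h *: 1) -
    g (x + t *: v))) =
  (fun h : R => h^-1 *: ((g \o shift (x + t *: v)) (h *: v) - g (x + t *: v))).
  by apply/funext => h /=; rewrite [h *: 1]mulr1 scalerDl addrCA.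
by split; [rewrite /derivable E|rewrite /derive E].
Qed.

Lemma MVT_direction_ge0 g (dg : 'cV[R]_m -> R) x v (h : R) : 0 <= h ->
  (forall y, is_derive y v g (dg y)) ->
  exists2 s : R, 0 <= s <= h & g (x + h *: v) - g x = h * dg (x + s *: v).
Proof.
move=> h0 gd.
have dG (t : R) : is_derive t 1 (fun s : R => g (x + s *: v)) (dg (x + t *: v)).
  by apply: is_derive_line; exact: gd.
have cG : {within `[0, h], continuous (fun s : R => g (x + s *: v))}.
  by apply: derivable_within_continuous => y _; case: (dG y).
have [c] := MVT_segment h0 (fun y _ => dG y) cG.
rewrite in_itv/= scale0r addr0 subr0 => c0h E.
by exists c => //; rewrite E mulrC.
Qed.

Lemma MVT_direction g (dg : 'cV[R]_m -> R) x v (h : R) :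
  (forall y, is_derive y v g (dg y)) ->
  exists2 s : R, `|s| <= `|h| & g (x + h *: v) - g x = h * dg (x + s *: v).
Proof.
move=> gd; have [h0|h0] := leP 0 h.
  have [s /andP[s0 sh] E] := MVT_direction_ge0 x h0 gd.
  by exists s => //; rewrite !ger0_norm.
have hN : 0 <= - h by rewrite oppr_ge0 ltW.
have [s /andP[s0 sh]] := MVT_direction_ge0 (x + h *: v) hN gd.
rewrite scaleNr addrK => E; exists (h + s).
  by rewrite (ltr0_norm h0) ler_norml; apply/andP; split; lra.
by rewrite -opprB E mulNr opprK scalerDl addrA.
Qed.

(** Only partial derivatives along the basis vectors occur, as in [C2]; first-order expansion is
    recovered by [mean_value_box]. *)
Definition C1s g : Prop := continuous g /\ forall j : 'I_m,
  (forall x, derivable g x (evec j)) /\ continuous (fun x => 'D_(evec j) g x).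

Lemma C1sD f g : C1s f -> C1s g -> C1s (fun x => f x + g x).
Proof.
move=> [cf df] [cg dg]; split=> [x|j]; first exact: continuousD (cf x) (cg x).
have [fj cfj] := df j; have [gj cgj] := dg j; split=> [x|].
  exact: (@derivableD _ _ _ f g).
have -> : (fun x => 'D_(evec j) (fun y => f y + g y) x) =
    (fun x => 'D_(evec j) f x + 'D_(evec j) g x).
  by apply/funext => x; exact: (@deriveD _ _ _ f g).
by move=> x; exact: continuousD (cfj x) (cgj x).
Qed.

Lemma deriveM_fun f g j : C1s f -> C1s g ->
  (fun x => 'D_(evec j) (fun y => f y * g y) x) =
  (fun x => f x * 'D_(evec j) g x + g x * 'D_(evec j) f x).
Proof.
move=> [cf df] [cg dg]; apply/funext => x; apply: (@deriveM _ _ f g).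
  exact: (df j).1.
exact: (dg j).1.
Qed.

Lemma C1sM f g : C1s f -> C1s g -> C1s (fun x => f x * g x).
Proof.
move=> Cf Cg; have [cf df] := Cf; have [cg dg] := Cg.
split=> [x|j]; first exact: continuousM (cf x) (cg x).
have [fj cfj] := df j; have [gj cgj] := dg j; split=> [x|].
  exact: (@derivableM _ _ f g).
rewrite (deriveM_fun j Cf Cg) => x.
exact: continuousD (continuousM (cf x) (cgj x)) (continuousM (cg x) (cfj x)).
Qed.

Lemma C1s_cst (c : R) : C1s (fun=> c).
Proof.
split=> [x|j]; first exact: cst_continuous.
split=> [x|]; first exact: derivable_cst.
have -> : (fun x : 'cV[R]_m => 'D_(evec j) (fun=> c) x) = (fun=> 0).
  by apply/funext => x; exact: derive_cst.
by move=> x; exact: cst_continuous.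
Qed.

Lemma C1s_sum (I : Type) (r : seq I) (F : I -> 'cV[R]_m -> R) :
  (forall i, C1s (F i)) -> C1s (fun x => \sum_(i <- r) F i x).
Proof.
move=> FC; elim: r => [|i r IH].
  by under [X in C1s X]eq_fun do rewrite big_nil; exact: C1s_cst.
by under [X in C1s X]eq_fun do rewrite big_cons; exact: C1sD.
Qed.

Lemma derive_sum_fun (I : Type) (r : seq I) (F : I -> 'cV[R]_m -> R) j :
  (forall i, C1s (F i)) ->
  (fun x => 'D_(evec j) (fun y => \sum_(i <- r) F i y) x) =
  (fun x => \sum_(i <- r) 'D_(evec j) (F i) x).
Proof.
move=> FC; elim: r => [|i r IH]; apply/funext => x.
  have -> : (fun y => \sum_(i <- [::]) F i y) = (fun=> 0).
    by apply/funext => y; rewrite big_nil.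
  by rewrite big_nil; exact: derive_cst.
have -> : (fun y => \sum_(i <- i :: r) F i y) = (fun y => F i y + \sum_(i <- r) F i y).
  by apply/funext => y; rewrite big_cons.
rewrite big_cons -(congr1 (@^~ x) IH); apply: (@deriveD _ _ _ (F i)).
  exact: ((FC i).2 j).1.
exact: ((C1s_sum r FC).2 j).1.
Qed.

(* Both mixed derivatives are limits of the same second difference quotient. *)
Lemma derive_swap g x (i j : 'I_m) : C1s g ->
  (forall k, C1s (fun y => 'D_(evec k) g y)) ->
  'D_(evec i) (fun y => 'D_(evec j) g y) x = 'D_(evec j) (fun y => 'D_(evec i) g y) x.
Proof.
move=> [cg dg] C2g.
have diff2 (a b : 'I_m) (h : R) : exists st : R * R, [/\ `|st.1| <= `|h|, `|st.2| <= `|h| &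
    g (x + h *: evec a + h *: evec b) - g (x + h *: evec a)
      - (g (x + h *: evec b) - g x) =
    h * (h * 'D_(evec b) (fun y => 'D_(evec a) g y) (x + st.1 *: evec a + st.2 *: evec b))].
  (* The mean value theorem is applied twice: along [evec a] to the increment [phi], then along
     [evec b] to the partial derivative of [g] in direction [a]. *)
  pose phi y := g (y + h *: evec b) - g y.
  have dphi y : is_derive y (evec a) phi
      ('D_(evec a) g (y + h *: evec b) - 'D_(evec a) g y).
    apply: (@is_deriveB _ _ _ (fun y => g (y + h *: evec b)) g).
      have [gd gE] := derivableP ((dg a).1 (y + h *: evec b)).
      have E : (fun t : R => t^-1 *: (((fun y => g (y + h *: evec b)) \o shift y) (t *: evec a) -
          g (y + h *: evec b))) = (fun t : R => t^-1 *: ((g \o shift (y + h *: evec b)) (t *: evec a)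
          - g (y + h *: evec b))).
        by apply/funext => t /=; rewrite addrA.
      by split; [rewrite /derivable E|rewrite /derive E].
    exact/derivableP/(dg a).1.
  have [s sh E1] := MVT_direction x h dphi.
  have dab y : is_derive y (evec b) (fun y => 'D_(evec a) g y)
      ('D_(evec b) (fun y => 'D_(evec a) g y) y).
    exact/derivableP/((C2g a).2 b).1.
  have [t th E2] := MVT_direction (x + s *: evec a) h dab.
  by exists (s, t); split=> //; rewrite -E2 -E1 /phi.
pose P y := 'D_(evec i) (fun y => 'D_(evec j) g y) y.
pose Q y := 'D_(evec j) (fun y => 'D_(evec i) g y) y.
have cP : continuous P := ((C2g j).2 i).2.
have cQ : continuous Q := ((C2g i).2 j).2.
apply/eqP; rewrite -subr_eq0 -normr_eq0; apply/eqP/le_anti; rewrite normr_ge0 andbT.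
apply/ler_addgt0Pl => e e0; rewrite addr0 -/(P x) -/(Q x).
have e2 : 0 < e / 2 by rewrite divr_gt0.
have /cvgrPdist_lt/(_ _ e2)/nbhs_ballP[r1 /= r10 h1] := cP x.
have /cvgrPdist_lt/(_ _ e2)/nbhs_ballP[r2 /= r20 h2] := cQ x.
(* Two offsets of length at most [h] add up to at most 2h, strictly less than both radii. *)
pose h := Num.min r1 r2 / 3.
have mr : 0 < Num.min r1 r2 by rewrite lt_min r10.
have h0 : 0 < h by rewrite divr_gt0.
have near_ball (a b : 'I_m) (s t r : R) : `|s| <= `|h| -> `|t| <= `|h| ->
    3 * h <= r -> ball x r (x + s *: evec a + t *: evec b).
  move=> sh th hr; rewrite -ball_normE/= -addrA opprD addrA subrr sub0r normrN.
  apply: le_lt_trans (ler_normD _ _) _; rewrite !normrZ.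
  have ev (k : 'I_m) : `|evec k : 'cV[R]_m| <= 1.
    rewrite /Num.norm/= mx_normrE; apply/bigmax_leP; split=> // -[a' b'] _.
    by rewrite !mxE/=; case: (_ && _); rewrite ?normr1 ?normr0.
  rewrite (gtr0_norm h0) in sh th.
  apply: (@le_lt_trans _ _ (h * 1 + h * 1)); last by lra.
  by apply: lerD; apply: ler_pM.
have [[s1 t1] [/= s1h t1h E1]] := diff2 i j h.
have [[s2 t2] [/= s2h t2h E2]] := diff2 j i h.
have sw (a b c d : R) : a - b - (c - d) = a - c - (b - d) by ring.
have PQ : Q (x + s1 *: evec i + t1 *: evec j) = P (x + s2 *: evec j + t2 *: evec i).
  apply: (mulfI (lt0r_neq0 h0)); apply: (mulfI (lt0r_neq0 h0)).
  apply: etrans (esym E1) (etrans _ E2); rewrite [x + h *: evec j + _]addrAC.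
  exact: (sw (g _)).
have h3 : 3 * h = Num.min r1 r2 by rewrite /h mulrC divfK.
clearbody P Q.
have b1 : `|P x - P (x + s2 *: evec j + t2 *: evec i)| < e / 2.
  by apply/h1/near_ball => //; rewrite h3 ge_min lexx.
have b2 : `|Q x - Q (x + s1 *: evec i + t1 *: evec j)| < e / 2.
  by apply/h2/near_ball => //; rewrite h3 ge_min lexx orbT.
rewrite PQ distrC in b2; apply: le_trans (ler_distD _ _ _) _.
by rewrite [leRHS]splitr; apply: lerD (ltW b1) (ltW b2).
Qed.

(** Walk from [x] to [x + h] by changing one coordinate at a time. Each increment is a one-variable
    mean value taken at a point of the box, where the gradient is within [eta] of [a] in each
    coordinate. *)
Lemma mean_value_box g x h (a : 'cV[R]_m) (eta : R) : C1s g ->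
  (forall y : 'cV[R]_m, (forall k, `|y k 0 - x k 0| <= `|h k 0|) ->
     forall i, `|grad g y i 0 - a i 0| <= eta) ->
  `|g (x + h) - g x - dotv a h| <= eta * \sum_i `|h i 0|.
Proof.
move=> [cg dg] ha.
pose z k : 'cV[R]_m := \col_i (x i 0 + if (i < k)%N then h i 0 else 0).
have z0 : z 0%N = x by apply/matrixP => i j; rewrite ord1 mxE ltn0 addr0.
have zm : z m = x + h by apply/matrixP => i j; rewrite ord1 !mxE ltn_ord.
have zS (k : 'I_m) : z k.+1 = z k + h k 0 *: evec k.
  apply/matrixP => i j; rewrite ord1 !mxE/= andbT -addrA; congr (_ + _).
  rewrite ltnS leq_eqVlt -val_eqE/=; case: eqVneq => [/val_inj->|_] /=.
    by rewrite ltnn mulr1 add0r.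
  by rewrite mulr0 addr0.
have -> : g (x + h) - g x = \sum_(k < m) (g (z k.+1) - g (z k)).
  by rewrite -(big_mkord xpredT (fun k => g (z k.+1) - g (z k))) telescope_sumr// zm z0.
rewrite /dotv -sumrB mulr_sumr; apply: le_trans (ler_norm_sum _ _ _) _.
apply: ler_sum => k _; rewrite zS.
have [s sh ->] := MVT_direction (z k) (h k 0) (fun y => derivableP ((dg k).1 y)).
rewrite [a k 0 * _]mulrC -mulrBr normrM mulrC ler_wpM2r//.
have := ha (z k + s *: evec k) _ k; rewrite [grad _ _ _ _]mxE; apply.
move=> i; rewrite !mxE/= andbT addrAC [x i 0 + _ - x i 0]addrAC subrr add0r.
have [->|_] := eqVneq i k; first by rewrite ltnn add0r mulr1.
by rewrite mulr0 addr0; case: ifP; rewrite ?normr0.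
Qed.
End calculus.

(** * Derivatives of the squared norm and the Armijo condition *)

Section sqnorm.
Variables (R : realType) (m m' : nat) (F : 'cV[R]_m -> 'cV[R]_m').
Hypothesis C2F : C2 F.
Local Notation f := (sqnormF F).

Definition half_grad (x : 'cV[R]_m) : 'cV[R]_m := (jac F x)^T *m F x.

Lemma C2_coord i : C1s (fun x => F x i 0) /\
  forall j, C1s (fun x => 'D_(evec j) (fun y => F y i 0) x).
Proof.
have [cF [dF ddF]] := C2F.
have coordE (G : 'cV[R]_m -> 'cV[R]_m') j : (forall x, derivable G x (evec j)) ->
    (fun x => 'D_(evec j) (fun y => G y i 0) x) = (fun x => ('D_(evec j) G x) i 0).
  by move=> dG; apply/funext => x; rewrite (derive_mx (dG x)) mxE.
have coordC (G : 'cV[R]_m -> 'cV[R]_m') : continuous G -> continuous (fun x => G x i 0).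
  move=> cG x; apply: (@continuous_comp _ _ _ G (fun y => y i 0)); first exact: cG.
  exact: coord_continuous.
split=> [|j].
  split=> [|j]; first exact: coordC.
  split=> [x|]; first by have /derivable_mxP := (dF j).1 x; apply.
  by rewrite (coordE _ _ (dF j).1); exact/coordC/(dF j).2.
rewrite (coordE _ _ (dF j).1); split=> [|k]; first exact/coordC/(dF j).2.
split=> [x|]; first by have /derivable_mxP := (ddF k j).1 x; apply.
by rewrite (coordE _ _ (ddF k j).1); exact/coordC/(ddF k j).2.
Qed.

Lemma sqnormFE : f = (fun x => \sum_i F x i 0 * F x i 0).
Proof. by apply/funext => x; rewrite /sqnormF sqr_enorm. Qed.

Lemma derive_sqnormF j : (fun x => 'D_(evec j) f x) =
  (fun x => \sum_i (F x i 0 * 'D_(evec j) (fun y => F y i 0) x +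
                    F x i 0 * 'D_(evec j) (fun y => F y i 0) x)).
Proof.
rewrite sqnormFE derive_sum_fun => [|i]; last by apply: C1sM; exact: (C2_coord i).1.
apply/funext => x; apply: eq_bigr => i _.
by have /(congr1 (@^~ x)) := deriveM_fun j (C2_coord i).1 (C2_coord i).1.
Qed.

Lemma C1s_sqnormF : C1s f.
Proof. by rewrite sqnormFE; apply: C1s_sum => i; apply: C1sM; exact: (C2_coord i).1. Qed.

Lemma C1s_derive_sqnormF j : C1s (fun x => 'D_(evec j) f x).
Proof.
rewrite derive_sqnormF; apply: C1s_sum => i.
by apply: C1sD; apply: C1sM; [exact: (C2_coord i).1|exact: (C2_coord i).2|
  exact: (C2_coord i).1|exact: (C2_coord i).2].
Qed.

Lemma grad_sqnormF x : grad f x = 2 *: half_grad x.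
Proof.
apply/matrixP => j k; rewrite ord1 !mxE.
have /(congr1 (@^~ x)) /= -> := derive_sqnormF j.
rewrite mulr_sumr; apply: eq_bigr => i _; rewrite !mxE.
rewrite (derive_mx ((C2F.2.1 j).1 x)) mxE; ring.
Qed.

Lemma hess_sqnormF_sym x : (hess f x)^T = hess f x.
Proof.
apply/matrixP => i j; rewrite !mxE; apply: derive_swap; first exact: C1s_sqnormF.
exact: C1s_derive_sqnormF.
Qed.

Lemma continuous_bigsum (T : topologicalType) (I : Type) (r : seq I) (G : I -> T -> R) (x : T) :
  (forall i, {for x, continuous (G i)}) -> {for x, continuous (fun y => \sum_(i <- r) G i y)}.
Proof.
move=> Gc; elim: r => [|i r IH].
  by under [X in {for x, continuous X}]eq_fun do rewrite big_nil; exact: cst_continuous.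
under [X in {for x, continuous X}]eq_fun do rewrite big_cons.
exact: continuousD (Gc i) IH.
Qed.

Lemma hess_bounded (x0 : 'cV[R]_m) : exists2 M : R, 0 < M &
  \forall x \near x0, \sum_i \sum_j `|hess f x i j| <= M.
Proof.
pose G x := \sum_i \sum_j `|hess f x i j|.
have cG : {for x0, continuous G}.
  apply: continuous_bigsum => i; apply: continuous_bigsum => j.
  apply: (@continuous_comp _ _ _ (fun x => hess f x i j) (fun y => `|y|)).
    have -> : (fun x => hess f x i j) = (fun x => 'D_(evec i) (fun y => 'D_(evec j) f y) x).
      by apply/funext => x; rewrite mxE.
    exact: ((C1s_derive_sqnormF j).2 i).2.
  exact: norm_continuous.
exists (G x0 + 1); first by rewrite ltr_wpDl// sumr_ge0// => i _; exact: sumr_ge0.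
have /cvgrPdist_lt/(_ 1 ltr01) := cG; apply: filterS => x.
rewrite -/(G x); move: (G x) (G x0) => a b.
by rewrite ltr_norml => /andP[h _]; lra.
Qed.

Lemma half_grad_continuous j (x : 'cV[R]_m) : {for x, continuous (fun y => half_grad y j 0)}.
Proof.
have -> : (fun y => half_grad y j 0) = (fun y => 2^-1 * 'D_(evec j) f y).
  apply/funext => y; have := grad_sqnormF y => /matrixP/(_ j 0); rewrite !mxE => ->.
  by rewrite mulrA mulVf ?mul1r.
by apply: continuousM; [exact: cst_continuous|exact: (C1s_sqnormF.2 j).2].
Qed.

Lemma enorm_half_grad_continuous (x : 'cV[R]_m) :
  {for x, continuous (fun y => enorm (half_grad y))}.
Proof.
apply: (@continuous_comp _ _ _ (fun y => dotv (half_grad y) (half_grad y)) Num.sqrt);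
  last exact: sqrt_continuous.
apply: continuous_bigsum => i.
exact: (@continuousM _ _ (fun y => half_grad y i 0) (fun y => half_grad y i 0) x
  (@half_grad_continuous i x) (@half_grad_continuous i x)).
Qed.

Lemma enormF_continuous (x : 'cV[R]_m) : {for x, continuous (fun y => enorm (F y))}.
Proof.
apply: (@continuous_comp _ _ _ (fun y => dotv (F y) (F y)) Num.sqrt); last exact: sqrt_continuous.
apply: continuous_bigsum => i; apply: continuousM; exact: (C2_coord i).1.1.
Qed.

Lemma norm_coord_le_enorm n (u : 'cV[R]_n) i : `|u i 0| <= enorm u.
Proof.
rewrite -ler_sqr ?nnegrE ?enorm_ge0// sqr_enorm real_normK ?num_real//.
by rewrite /dotv (bigD1 i)//= -expr2 lerDl sumr_ge0// => j _; rewrite -expr2 sqr_ge0.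
Qed.

Lemma mxnorm_le_enorm n (u : 'cV[R]_n) : `|u| <= enorm u.
Proof.
rewrite /Num.norm/= mx_normrE; apply/bigmax_leP; split; first exact: enorm_ge0.
by move=> [i j] _ /=; rewrite ord1 norm_coord_le_enorm.
Qed.

Lemma norm_coord_le_mxnorm n (u : 'cV[R]_n) i : `|u i 0| <= `|u|.
Proof. by rewrite [leRHS]/Num.norm/= mx_normrE; exact: (le_bigmax _ _ (i, 0)). Qed.

(** The gradient is twice [half_grad], so the linearized decrease is 2 gamma <wh, g>, while the
    condition asks for half of it. The other half, at least gamma eps, absorbs the variation of the
    gradient, which costs at most 2 gamma eta m. *)
Lemma armijo_uniform (x0 : 'cV[R]_m) (eps : R) : 0 < eps ->
  exists2 rho : R, 0 < rho & forall x wh (gamma : R), `|x - x0| < rho -> enorm wh <= 1 ->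
    eps <= dotv wh (half_grad x) -> 0 < gamma <= rho -> armijo F x wh gamma.
Proof.
move=> eps0; pose eta := eps / (2 * m.+1%:R).
have eta0 : 0 < eta by rewrite divr_gt0// mulr_gt0// ltr0n.
have /filter_forall : forall i, \forall y \near x0, `|grad f y i 0 - grad f x0 i 0| <= eta.
  move=> i.
  have /cvgrPdist_le/(_ _ eta0) := (C1s_sqnormF.2 i).2 x0.
  by apply: filterS => y; rewrite distrC !mxE.
move=> /nbhs_ballP[r /= r0 hr]; exists (r / 2); first by rewrite divr_gt0.
move=> x wh gamma xr wh1 wheps /andP[g0 gr].
have ballx (y : 'cV[R]_m) : (forall k, `|y k 0 - x k 0| <= `|(- gamma *: wh) k 0|) -> ball x0 r y.
  move=> hy; split=> // i j; rewrite ord1 /ball/= distrC.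
  have := hy i; rewrite !mxE normrM normrN (gtr0_norm g0) => yi.
  have : `|x i 0 - x0 i 0| < r / 2.
    by apply: le_lt_trans xr; have := norm_coord_le_mxnorm (x - x0) i; rewrite !mxE.
  have : gamma * `|wh i 0| <= r / 2.
    rewrite -[leRHS]mulr1 ler_pM ?(ltW g0)//.
    exact: le_trans (norm_coord_le_enorm _ _) wh1.
  have := ler_distD (x i 0) (y i 0) (x0 i 0); lra.
have := @mean_value_box _ _ f x (- gamma *: wh) (grad f x0) eta C1s_sqnormF.
move=> /(_ (fun y hy => hr y (ballx y hy))).
have sumh : \sum_i `|(- gamma *: wh) i 0| <= gamma * m%:R.
  have -> : gamma * m%:R = \sum_(i < m) gamma * 1.
    by rewrite sumr_const card_ord mulr1 mulr_natr.
  apply: ler_sum => i _; rewrite !mxE normrM normrN (gtr0_norm g0) ler_pM2l//.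
  exact: le_trans (norm_coord_le_enorm _ _) wh1.
rewrite dotvZr => mv.
have gx : `|dotv (grad f x0) wh - 2 * dotv wh (half_grad x)| <= eta * m%:R.
  rewrite -dotvZr -grad_sqnormF dotvC -dotvBr /dotv.
  apply: le_trans (ler_norm_sum _ _ _) _.
  have -> : eta * m%:R = \sum_(i < m) 1 * eta.
    by rewrite sumr_const card_ord mul1r mulr_natr.
  apply: ler_sum => i _; rewrite normrM ler_pM//.
    exact: le_trans (norm_coord_le_enorm _ _) wh1.
  have -> : (grad f x0 - grad f x) i 0 = grad f x0 i 0 - grad f x i 0 by rewrite !mxE.
  rewrite distrC; apply: hr.
  by apply: ballx => k; rewrite subrr normr0.
have em : 2 * (eta * m%:R) <= eps.
  have m1 : 0 < (m.+1%:R : R) by rewrite ltr0n.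
  have epsE : eps = 2 * (eta * m.+1%:R) by rewrite /eta; field; rewrite gt_eqF.
  by rewrite [leRHS]epsE ler_pM2l// ler_pM2l// ler_nat.
rewrite /armijo -/(half_grad x) -scaleNr.
set D := dotv wh (half_grad x) in wheps gx *; set P := dotv (grad f x0) wh in mv gx.
move: mv; rewrite ler_norml => /andP[_ mv]; move: gx; rewrite ler_norml => /andP[gx _].
have e1 : eta * \sum_i `|(- gamma *: wh) i 0| <= gamma * (eta * m%:R).
  by rewrite mulrCA ler_pM2l.
have e2 : gamma * (2 * D - eta * m%:R) <= gamma * P by rewrite ler_pM2l//; lra.
have e3 : gamma * (2 * (eta * m%:R)) <= gamma * D by rewrite ler_pM2l//; lra.
move: e1 e2 e3 mv; set S := eta * \sum_i _; set T := eta * m%:R; clearbody S T => *; nra.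
Qed.

End sqnorm.

(** * One step of the method *)

Section step.
Variables (R : realType) (m m' : nat) (F : 'cV[R]_m -> 'cV[R]_m').
Hypothesis C2F : C2 F.
Variables (delta : 'I_m.+1 -> R) (tau : R).
Hypothesis tau01 : 0 < tau < 1.
Hypothesis deltaP : bnqn_params delta.
Local Notation f := (sqnormF F).
Implicit Types (x : 'cV[R]_m).

(** Finitely many distinct parameters have a positive least gap. For m = 0 there is no pair of
    distinct indices, and the infimum of the empty set is 0 by convention. *)
Lemma kappa_gt0 : (0 < m)%N -> 0 < kappa delta.
Proof.
move=> m0; rewrite /kappa divr_gt0//.
pose b := \big[Num.min/1]_(ij : 'I_m.+1 * 'I_m.+1 | ij.1 != ij.2)
  `|delta ij.1 - delta ij.2|.
have b0 : 0 < b.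
  apply: (big_ind (fun z : R => 0 < z)) => // [z t|[i j] /= ij].
    by rewrite lt_min => -> ->.
  by rewrite normr_gt0 subr_eq0; apply: contraNneq ij => /deltaP.1 ->.
apply: lt_le_trans b0 _; apply: lb_le_inf.
  exists `|delta ord0 - delta ord_max|, ord0, ord_max; split=> //.
  by rewrite -val_eqE/= eq_sym -lt0n.
by move=> d [i [j [ij ->]]]; apply: (bigmin_le_cond _ (j := (i, j))).
Qed.

Let dsum := \sum_i delta i.

Lemma delta_le_sum j : delta j <= dsum.
Proof.
by rewrite /dsum (bigD1 j)//= lerDl sumr_ge0// => i _; exact/ltW/deltaP.2.
Qed.

Lemma dsum_gt0 : 0 < dsum.
Proof. exact: lt_le_trans (deltaP.2 ord0) (delta_le_sum ord0). Qed.

Lemma choose_A_sym x A : choose_A F delta tau x A -> A^T = A.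
Proof.
by move=> [j [_ [_ ->]]]; rewrite linearD/= hess_sqnormF_sym// tr_scalar_mx.
Qed.

Lemma choose_A_upper x A l : choose_A F delta tau x A -> eigenvalue A l ->
  `|l| <= \sum_i \sum_j `|hess f x i j| +
          dsum * Num.max (enorm (F x)) (enorm (F x) `^ tau).
Proof.
move=> [j [_ [_ ->]]] /eigenvalue_shift/eigenvalue_le_sum.
set s := if _ then _ else _; set H := \sum_i _ => lH.
have s0 : 0 <= s by rewrite /s; case: ifP => _; rewrite ?enorm_ge0 ?powR_ge0.
have sM : s <= Num.max (enorm (F x)) (enorm (F x) `^ tau).
  by rewrite /s; case: ifP => _; rewrite le_max lexx ?orbT.
rewrite -[l](subrK (delta j * s)) (le_trans (ler_normD _ _))// lerD// normrM.
rewrite (ger0_norm s0) (gtr0_norm (deltaP.2 j)) ler_pM ?delta_le_sum//.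
exact/ltW/deltaP.2.
Qed.

Lemma choose_A_lower x A l : (0 < m)%N -> choose_A F delta tau x A -> eigenvalue A l ->
  kappa delta * Num.min (enorm (F x)) (enorm (F x) `^ tau) <= `|l|.
Proof.
move=> m0 [j [+ [_ ->]]] /minsp_le; set s := if _ then _ else _ => h1 h2.
apply: le_trans (le_trans h1 h2); rewrite ler_pM2l ?kappa_gt0//.
by rewrite /s; case: ifP => _; rewrite ge_min lexx ?orbT.
Qed.

(* In the branch [s = |F|] the spectral gap of the Hessian itself, which exceeds
   [|F|^tau], dominates the shift. *)
Lemma choose_A_lower_zero x A l : (0 < m)%N -> choose_A F delta tau x A -> eigenvalue A l ->
  dsum * enorm (F x) <= enorm (F x) `^ tau / 2 ->
  Num.min (kappa delta) 2^-1 * enorm (F x) `^ tau <= `|l|.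
Proof.
move=> m0 [j [+ [_ ->]]] Al small; set s := if _ then _ else _ => h1.
have p0 := powR_ge0 (enorm (F x)) tau.
have := minsp_le Al; move: (eigenvalue_shift Al) => /minsp_le; move: h1.
rewrite /s; case: ifP => [gap _ h2 _|_ h1 _ h2]; last first.
  apply: le_trans (le_trans h1 h2); rewrite ler_wpM2r//.
  by rewrite ge_min lexx.
apply: (@le_trans _ _ (2^-1 * enorm (F x) `^ tau)).
  by rewrite ler_wpM2r// ge_min lexx orbT.
have dj : `|delta j * enorm (F x)| <= enorm (F x) `^ tau / 2.
  rewrite ger0_norm; last by rewrite mulr_ge0 ?enorm_ge0// ltW// deltaP.2.
  by apply: le_trans small; rewrite ler_wpM2r ?enorm_ge0 ?delta_le_sum.
have := ler_distD (delta j * enorm (F x)) l 0; rewrite !subr0.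
have := ler_normB l (delta j * enorm (F x)).
by move: dj gap h2; set a := minsp _; lra.
Qed.

Lemma choose_A_upper_near x0 : exists2 M : R, 0 < M & \forall x \near x0,
  forall A l, choose_A F delta tau x A -> eigenvalue A l -> `|l| <= M.
Proof.
(* As B >= 1 and tau < 1, B^tau <= B, so one bound covers both scalings of the shift. *)
have [H H0 hH] := hess_bounded C2F x0; pose B := 1 + enorm (F x0).
have B1 : 1 <= B by rewrite lerDl enorm_ge0.
have B0 : 0 < B by apply: lt_le_trans B1.
exists (H + dsum * B); first by rewrite addr_gt0// mulr_gt0// dsum_gt0.
have nB : \forall x \near x0, enorm (F x) <= B.
  have /cvgrPdist_lt/(_ 1 ltr01) := enormF_continuous C2F (x:=x0).
  apply: filterS => x; rewrite /B; move: (enorm (F x)) (enorm (F x0)) => a b.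
  by rewrite ltr_norml => /andP[h _]; lra.
near=> x => A l hA Al; apply: le_trans (choose_A_upper hA Al) _.
apply: lerD; first by near: x; exact: hH.
have nx : enorm (F x) <= B by near: x.
rewrite ler_pM2l ?dsum_gt0// ge_max nx/=.
have [t0 t1] := andP tau01.
apply: (@le_trans _ _ (B `^ tau)).
  by apply: ge0_ler_powR; rewrite ?nnegrE ?enorm_ge0// ltW.
by rewrite -[leRHS](powRr1 (ltW B0)) ler_powR// ltW.
Unshelve. all: by end_near.
Qed.

Lemma choose_A_spectrum_nonzero x0 : (0 < m)%N -> F x0 != 0 ->
  exists sigma M : R, [/\ 0 < sigma, 0 < M & \forall x \near x0,
    forall A l, choose_A F delta tau x A -> eigenvalue A l -> sigma <= `|l| <= M].
Proof.
move=> m0 F0; have [M M0 hM] := choose_A_upper_near x0.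
pose n0 := enorm (F x0) / 2.
have nx0 : 0 < enorm (F x0) by rewrite lt_def enorm_eq0 F0 enorm_ge0.
have n00 : 0 < n0 by rewrite divr_gt0.
exists (kappa delta * Num.min n0 (n0 `^ tau)), M; split=> //.
  by rewrite mulr_gt0 ?kappa_gt0// lt_min n00 powR_gt0.
have nB : \forall x \near x0, n0 <= enorm (F x).
  have /cvgrPdist_lt/(_ _ n00) := enormF_continuous C2F (x:=x0).
  apply: filterS => x; rewrite /n0; move: (enorm (F x)) (enorm (F x0)) => a b.
  by rewrite ltr_norml => /andP[_ h]; lra.
near=> x => A l hA Al; apply/andP; split; last first.
  by move: A l hA Al; near: x; exact: hM.
have nx : n0 <= enorm (F x) by near: x.
apply: le_trans (choose_A_lower m0 hA Al); rewrite ler_pM2l ?kappa_gt0//.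
have [t0 t1] := andP tau01.
rewrite le_min !ge_min nx/= [X in _ || X](_ : _ = true) ?orbT//.
by apply: ge0_ler_powR; rewrite ?nnegrE ?enorm_ge0// ltW.
Unshelve. all: by end_near.
Qed.

Lemma choose_A_spectrum_zero x0 : (0 < m)%N -> F x0 = 0 ->
  exists k M : R, [/\ 0 < k, 0 < M & \forall x \near x0,
    forall A l, choose_A F delta tau x A -> eigenvalue A l ->
      k * enorm (F x) `^ tau <= `|l| <= M].
Proof.
move=> m0 F0; have [M M0 hM] := choose_A_upper_near x0.
have [t0 t1] := andP tau01; have nu0 : 0 < 1 - tau by lra.
(* The inequality |F|^(1 - tau) <= 1 / (2 dsum) is the smallness condition of [choose_A_lower_zero].
   It holds near a zero of [F] because tau < 1. *)
have K0 : 0 < (2 * dsum)^-1 by rewrite invr_gt0 mulr_gt0// dsum_gt0.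
have [eta eta0 etaP] := powR_small nu0 K0.
exists (Num.min (kappa delta) 2^-1), M; split=> //.
  by rewrite lt_min kappa_gt0//= invr_gt0.
have nB : \forall x \near x0, enorm (F x) <= eta.
  have /cvgrPdist_lt/(_ _ eta0) := enormF_continuous C2F (x:=x0).
  have -> : enorm (F x0) = 0 by apply/eqP; rewrite enorm_eq0 F0.
  apply: filterS => x; move: (enorm (F x)) => a.
  by rewrite ltr_norml => /andP[h _]; lra.
near=> x => A l hA Al; apply/andP; split; last first.
  by move: A l hA Al; near: x; exact: hM.
have nx : enorm (F x) <= eta by near: x.
apply: choose_A_lower_zero m0 hA Al _.
have h : enorm (F x) `^ (1 - tau) <= (2 * dsum)^-1 by apply: etaP; rewrite enorm_ge0.
have nE : enorm (F x) = enorm (F x) `^ (1 - tau) * enorm (F x) `^ tau.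
  by rewrite -powRD ?subrK ?powRr1 ?enorm_ge0// oner_eq0.
rewrite [X in dsum * X]nE mulrA [leRHS]mulrC ler_wpM2r ?powR_ge0//.
apply: (@le_trans _ _ (dsum * (2 * dsum)^-1)); first by rewrite ler_pM2l ?dsum_gt0.
by rewrite invfM mulrCA divff ?mulr1// gt_eqF// dsum_gt0.
Unshelve. all: by end_near.
Qed.

(** Multiplying the two bounds of [newton_direction] gives (sigma/M) |w|^2 |g|^2 <= <w, g>^2, and
    its square root is compatible with rescaling [w]. For the last bound, an untruncated direction
    has <w, g> >= |g|^2 / M, and a truncated one has <w, g> / |w| >= sigma |w| >= sigma. *)
Lemma step_direction x x' (sigma M : R) : bnqn_step F delta tau x x' ->
  half_grad F x <> 0 -> 0 < sigma -> 0 < M ->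
  (forall A l, choose_A F delta tau x A -> eigenvalue A l -> sigma <= `|l| <= M) ->
  exists (wh : 'cV[R]_m) (gamma : R),
    [/\ 0 < gamma, armijo F x wh gamma,
        forall n, armijo F x wh (2%:R ^- n) -> 2%:R ^- n <= gamma &
        x' = x - gamma *: wh] /\
    [/\ enorm wh <= 1,
        Num.sqrt (sigma / M) * enorm wh * enorm (half_grad F x) <= dotv wh (half_grad F x) &
        Num.min sigma (enorm (half_grad F x) ^+ 2 / M) <= dotv wh (half_grad F x)].
Proof.
move=> [[]//|[_ [A [p [q [gamma [hA [hp [hq [[gamma2 [harm hmax]] x'E]]]]]]]]]] gx s0 M0 hs.
have [] := newton_direction (choose_A_sym hA) s0 (fun l => hs A l hA) erefl hp hq.
set g := half_grad F x; set w := p - q in harm hmax x'E * => wg gg.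
pose n := enorm w; rewrite -/n in wg; pose mx := Num.max 1 n.
have mx1 : 1 <= mx by rewrite le_max lexx.
have mx0 : 0 < mx by apply: lt_le_trans mx1.
have wmx : n <= mx by rewrite le_max lexx orbT.
exists (mx^-1 *: w), gamma; split.
  split=> //; have [k ->] := gamma2; by rewrite invr_gt0 exprn_gt0.
rewrite enormZ gtr0_norm ?invr_gt0// dotvZl -/n.
set d := dotv w g in wg gg *.
have n0 : 0 <= n := enorm_ge0 _.
have d0 : 0 <= d by apply: le_trans wg; rewrite mulr_ge0 ?sqr_ge0// ltW.
split.
- by rewrite mulrC ler_pdivrMr// mul1r.
- rewrite [X in X <= _](_ : _ = mx^-1 * (Num.sqrt (sigma / M) * n * enorm g)); last by ring.
  rewrite ler_pM2l ?invr_gt0//.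
  rewrite -ler_sqr ?nnegrE ?mulr_ge0 ?sqrtr_ge0 ?enorm_ge0//.
  rewrite !exprMn sqr_sqrtr; last by rewrite divr_ge0 ?ltW.
  rewrite [leLHS](_ : _ = (sigma * n ^+ 2) * (enorm g ^+ 2 / M)); last by ring.
  rewrite [leRHS]expr2; apply: ler_pM => //.
  + by apply: mulr_ge0; [exact: ltW|exact: sqr_ge0].
  + by apply: divr_ge0; [exact: sqr_ge0|exact: ltW].
  + by rewrite ler_pdivrMr// mulrC.
- rewrite ge_min; have [n1|n1] := leP n 1.
    rewrite /mx (max_idPl n1) invr1 mul1r; apply/orP; right.
    by rewrite ler_pdivrMr// mulrC.
  have -> : mx = n by rewrite /mx; apply/max_idPr/ltW.
  have n_gt0 : 0 < n by apply: lt_trans n1.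
  apply/orP; left; rewrite mulrC ler_pdivlMr//; apply: le_trans wg.
  by rewrite ler_pM2l// expr2 ler_peMr// ltW.
Qed.

End step.

(** * Convergence *)

Section convergence.
Variables (R : realType) (m : nat).
Implicit Types (x : nat -> 'cV[R]_m) (f : 'cV[R]_m -> R).

(** Young's inequality for r^alpha and 1, with conjugate exponents 1/alpha and 1/(1 - alpha). *)
Lemma powR_bernoulli (r alpha : R) : 0 <= r -> 0 < alpha < 1 ->
  r `^ alpha <= alpha * r + (1 - alpha).
Proof.
move=> r0 /andP[a0 a1]; have b0 : 0 < 1 - alpha by lra.
have ia : 0 < alpha^-1 by rewrite invr_gt0.
have ib : 0 < (1 - alpha)^-1 by rewrite invr_gt0.
have := conjugate_powR (powR_ge0 r alpha) (@ler01 R) ia ib.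
rewrite !invrK addrC subrK => /(_ erefl).
by rewrite mulr1 -powRrM divff ?gt_eqF// powRr1// powR1 mul1r mulrC.
Qed.

(** Tangent-line inequality for the concave power 1 - theta at [u], reduced by homogeneity to the
    ratio v/u. *)
Lemma powR_concave_gap (u v theta : R) : 0 < u -> 0 <= v -> 0 < theta < 1 ->
  (1 - theta) * (u - v) <= u `^ theta * (u `^ (1 - theta) - v `^ (1 - theta)).
Proof.
move=> u0 v0 /andP[t0 t1]; set al := 1 - theta.
have al01 : 0 < al < 1 by rewrite /al; apply/andP; split; lra.
have r0 : 0 <= v / u by rewrite divr_ge0// ltW.
have := powR_bernoulli r0 al01.
have vE : u * (v / u) = v by rewrite mulrC divfK// gt_eqF.
have vpE : v `^ al = u `^ al * (v / u) `^ al by rewrite -powRM// ?vE// ltW.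
have uE : u `^ theta * u `^ al = u.
  rewrite -powRD; last by rewrite (gt_eqF u0) implybT.
  by rewrite /al addrCA subrr addr0 powRr1 ?ltW.
move=> h; rewrite vpE [leRHS]mulrBr mulrA uE.
move: vE h; set p := (v / u) `^ al; set r := v / u => vE h.
have : u * p <= u * (al * r + (1 - al)) by rewrite ler_pM2l.
rewrite mulrDr mulrCA vE; clearbody p r; lra.
Qed.

Definition clusters_at x (y : 'cV[R]_m) : Prop :=
  forall (eps : R) N, 0 < eps -> exists2 n, (N <= n)%N & `|x n - y| < eps.

(** If the norms do not tend to infinity, infinitely many terms lie in a fixed cube, and compactness
    supplies a cluster point. *)
Lemma diverges_or_clusters x :
  (fun n => enorm (x n)) @ \oo --> +oo \/ exists y, clusters_at x y.
Proof.
have [|ninf] := pselect ((fun n => enorm (x n)) @ \oo --> +oo); [by left|right].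
have [B hB] : exists B : R, forall N, exists n, (N <= n)%N /\ enorm (x n) <= B.
  apply: contrapT => nB; apply: ninf; apply/cvgryPgt => B.
  have [N hN] : exists N, forall n, (N <= n)%N -> B < enorm (x n).
    apply: contrapT => nN; apply: nB; exists B => N; apply: contrapT => nn.
    apply: nN; exists N => n Nn; rewrite ltNge; apply/negP => xB.
    by apply: nn; exists n.
  by exists N => // n /= Nn; exact: hN.
have [phi phiP] := choice hB.
pose K := [set v : 'rV[R]_m | forall i, `[- B, B]%classic (v ord0 i)].
have cK : compact K.
  by apply: (@rV_compact _ _ (fun=> `[- B, B]%classic)) => i; exact: segment_compact.
pose z n := (x (phi n))^T.
have zK : (z @ \oo) K.
  exists 0%N => // n _ i; rewrite /= in_itv/= mxE -ler_norml.
  exact: le_trans (norm_coord_le_enorm _ _) (phiP n).2.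
have [y [_ yc]] := cK (z @ \oo) _ zK.
exists y^T => eps N eps0.
have zN : (z @ \oo) [set z n | n in [set n | (N <= n)%N]].
  by exists N => // n Nn; exists n.
have [_ [[n Nn <-] [_ yz]]] := yc _ _ zN (nbhsx_ballx y eps eps0).
exists (phi n); first exact: leq_trans Nn (phiP n).1.
rewrite [ltLHS]/Num.norm/= mx_normrE; apply/bigmax_ltP; split=> // -[i j] _ /=.
by have := yz 0 i; rewrite (ord1 j) !mxE /ball/= distrC.
Qed.

Lemma cluster_value_le x f y : clusters_at x y -> {for y, continuous f} ->
  (forall n, f (x n.+1) <= f (x n)) -> forall n, f y <= f (x n).
Proof.
move=> xy cf fx n; apply/ler_addgt0Pr => e e0.
have /cvgrPdist_lt/(_ _ e0)/nbhs_ballP[r /= r0 hr] := cf.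
have [k nk xk] := xy r n r0.
have := hr (x k); rewrite -ball_normE/= distrC => /(_ xk).
have : f (x k) <= f (x n).
  by elim: k nk {xk} => [|k IH]; [rewrite leqn0 => /eqP->|
    rewrite leq_eqVlt => /orP[/eqP->//|/IH]; exact: le_trans (fx k)].
move: (f (x k)) (f (x n)) (f y) => a b c ab; rewrite ltr_norml => /andP[_ h]; lra.
Qed.

Lemma cluster_near_value x f y (e : R) (P : 'cV[R]_m -> Prop) N :
  clusters_at x y -> {for y, continuous f} -> 0 < e -> (\forall z \near y, P z) ->
  exists n, [/\ (N <= n)%N, `|f (x n) - f y| < e & P (x n)].
Proof.
move=> xy cf e0 hP; have /cvgrPdist_lt/(_ _ e0) hf := cf.
have /nbhs_ballP[r /= r0 hr] : \forall z \near y, `|f z - f y| < e /\ P z.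
  by apply: filterS2 hf hP => z; rewrite distrC.
have [n Nn xn] := xy r N r0; exists n.
by have [] := hr (x n); rewrite -?ball_normE/= 1?distrC.
Qed.

(* The desingularized values [(f (x n) - f y) ^ (1 - theta)] bound the length
   of the remaining trajectory. *)
Lemma lojasiewicz_trapping x f y (a theta rho : R) :
  clusters_at x y -> {for y, continuous f} -> (forall n, f (x n.+1) <= f (x n)) ->
  0 < a -> 0 < theta < 1 -> 0 < rho ->
  (forall n, `|x n - y| < rho -> f y < f (x n) ->
     a * (f (x n) - f y) `^ theta * `|x n.+1 - x n| <= f (x n) - f (x n.+1)) ->
  (forall n, f (x n) = f y -> x n.+1 = x n) ->
  x @ \oo --> y.
Proof.
move=> xy cf fx a0 th01 rho0 hdec hstat; have [t0 t1] := andP th01.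
have al0 : 0 < 1 - theta by lra.
have fy := cluster_value_le xy cf fx.
pose psi n := (f (x n) - f y) `^ (1 - theta); pose K := (a * (1 - theta))^-1.
have K0 : 0 < K by rewrite invr_gt0 mulr_gt0.
have psi0 n : 0 <= psi n := powR_ge0 _ _.
have step n : `|x n - y| < rho -> `|x n.+1 - x n| <= K * psi n - K * psi n.+1.
  move=> xn; have [ffy|/eqP ffy] := eqVneq (f (x n)) (f y).
    by rewrite /psi hstat// ffy !subrr normr0.
  have u0 : 0 < f (x n) - f y.
    by rewrite subr_gt0 lt_def fy andbT; apply/eqP.
  have v0 : 0 <= f (x n.+1) - f y by rewrite subr_ge0.
  have := powR_concave_gap u0 v0 th01; rewrite -/(psi n) -/(psi n.+1).
  have := hdec n xn; rewrite -subr_gt0 => /(_ u0).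
  have := powR_gt0 theta u0; set U := _ `^ theta => U0 h1 h2.
  rewrite -mulrBr /K ler_pdivlMl ?mulr_gt0// -(ler_pM2l U0).
  apply: le_trans (_ : (1 - theta) * (f (x n) - f (x n.+1)) <= _).
    rewrite [leLHS](_ : _ = (1 - theta) * (a * U * `|x n.+1 - x n|)); last by ring.
    by rewrite ler_pM2l.
  by apply: le_trans h2; rewrite ler_pM2l//; lra.
apply/cvgrPdist_lt => e e0.
pose d := Num.min e rho / 2; have d0 : 0 < d by rewrite divr_gt0// lt_min e0.
have [eta eta0 etaP] := powR_small al0 (divr_gt0 d0 K0).
have dnear : \forall z \near y, `|z - y| < d.
  by apply/nbhs_ballP; exists d => //= z; rewrite -ball_normE/= distrC.
have [N [_ fN xN]] := cluster_near_value 0%N xy cf eta0 dnear.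
have psiN : K * psi N <= d.
  rewrite mulrC -ler_pdivlMr//; apply: etaP; rewrite subr_ge0 fy/=.
  by apply: le_trans (ltW fN); exact: ler_norm.
(* By [step], K psi drops by at least the length of each move, so distance plus K psi never
   increases. Both summands are at most half of the minimum of [e] and [rho] at [N], so the orbit
   stays where [hdec] applies and within [e] of [y]. *)
have trap n : (N <= n)%N -> `|x n - y| + K * psi n < Num.min e rho.
  elim: n => [|n IH].
    rewrite leqn0 => /eqP N0; rewrite N0 in xN psiN.
    rewrite [ltRHS]splitr; exact: ltr_leD.
  rewrite leq_eqVlt => /orP[/eqP N0|].
    by rewrite -N0 [ltRHS]splitr; exact: ltr_leD.
  rewrite ltnS => /IH h; apply: le_lt_trans (h).
  have xr : `|x n - y| < rho.
    apply: le_lt_trans (_ : _ <= `|x n - y| + K * psi n) _.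
      by rewrite lerDl mulr_ge0// ltW.
    by apply: lt_le_trans h _; rewrite ge_min lexx orbT.
  have := step n xr; have := ler_distD (x n) (x n.+1) y.
  move: (`|x n.+1 - y|) (`|x n.+1 - x n|) (`|x n - y|) (K * psi n) (K * psi n.+1) => *; lra.
exists N => // n /= Nn; rewrite distrC.
apply: le_lt_trans (_ : _ <= `|x n - y| + K * psi n) _.
  by rewrite lerDl mulr_ge0// ltW.
by apply: lt_le_trans (trap n Nn) _; rewrite ge_min lexx.
Qed.

End convergence.

(** * Convergence of the iterates of the method *)

Section sequence.
Variables (R : realType) (m m' : nat) (F : 'cV[R]_m -> 'cV[R]_m').
Hypothesis C2F : C2 F.
Variables (delta : 'I_m.+1 -> R) (tau : R).
Hypothesis tau01 : 0 < tau < 1.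
Hypothesis deltaP : bnqn_params delta.
Local Notation f := (sqnormF F).
Local Notation g := (half_grad F).
Local Notation step := (bnqn_step F delta tau).

Lemma half_grad_neq0_dim x : g x <> 0 -> (0 < m)%N.
Proof.
rewrite lt0n => gx; apply/eqP => m0; apply: gx; apply/matrixP => i.
by exfalso; move: (i); rewrite m0 => -[].
Qed.

Lemma half_grad_neq0_F x : g x <> 0 -> F x != 0.
Proof. by move=> gx; apply/eqP => Fx; apply: gx; rewrite /half_grad Fx mulmx0. Qed.

Lemma enorm_gt0 n (u : 'cV[R]_n) : u <> 0 -> 0 < enorm u.
Proof. by move/eqP => u0; rewrite lt_def enorm_eq0 u0 enorm_ge0. Qed.

(** The Armijo condition turns the angle bound of [step_direction] into a decrease proportional to
    the displacement. The displacement is measured in the entrywise maximum norm, which the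
    Euclidean norm dominates. *)
Lemma step_descent x x' (sigma M : R) : step x x' -> g x <> 0 -> 0 < sigma -> 0 < M ->
  (forall A l, choose_A F delta tau x A -> eigenvalue A l -> sigma <= `|l| <= M) ->
  Num.sqrt (sigma / M) * enorm (g x) * `|x' - x| <= f x - f x'.
Proof.
move=> st gx s0 M0 hs.
have [wh [gamma [[g0 arm _ ->] [_ h _]]]] := step_direction C2F st gx s0 M0 hs.
have : gamma * dotv wh (g x) <= f x - f (x - gamma *: wh).
  by move: arm; rewrite /armijo -/(g x) mulNr; lra.
apply: le_trans; rewrite addrAC subrr sub0r normrN.
apply: le_trans (_ : Num.sqrt (sigma / M) * enorm (g x) * (gamma * enorm wh) <= _).
  rewrite ler_wpM2l ?mulr_ge0 ?sqrtr_ge0 ?enorm_ge0//.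
  by rewrite normrZ gtr0_norm// ler_pM2l// mxnorm_le_enorm.
rewrite [leLHS](_ : _ = gamma * (Num.sqrt (sigma / M) * enorm wh * enorm (g x))).
  by rewrite ler_pM2l.
by ring.
Qed.

Lemma step_lt x x' : step x x' -> g x <> 0 -> f x' < f x.
Proof.
move=> st gx; have m0 := half_grad_neq0_dim gx.
have [sigma [M [s0 M0 hs]]] := choose_A_spectrum_nonzero C2F tau01 deltaP m0 (half_grad_neq0_F gx).
have {}hs := nbhs_singleton hs.
have [wh [gamma [[g0 arm _ x'E] [_ _ h]]]] := step_direction C2F st gx s0 M0 hs.
have d0 : 0 < dotv wh (g x).
  apply: lt_le_trans h; rewrite lt_min s0/= divr_gt0// exprn_gt0//.
  exact: enorm_gt0.
have gd : 0 < gamma * dotv wh (g x) by rewrite mulr_gt0.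
by move: arm; rewrite /armijo -/(g x) -x'E mulNr; lra.
Qed.

Lemma step_stationary x x' : step x x' -> g x = 0 -> x' = x.
Proof. by move=> [[_ ->]//|[gx _]] /gx. Qed.

Lemma step_le x x' : step x x' -> f x' <= f x.
Proof.
move=> st; have [gx|gx] := pselect (g x = 0); last exact/ltW/step_lt.
by rewrite (step_stationary st gx).
Qed.

Lemma criticalE x : critical f x <-> g x = 0.
Proof.
rewrite /critical grad_sqnormF//; split=> [/eqP|->]; last by rewrite scaler0.
by rewrite scaler_eq0 pnatr_eq0 => /eqP.
Qed.

(** Near a noncritical [y] the accepted step sizes and slopes are bounded below, so one step lowers
    [f] by at least a fixed [d]. Taken from an iterate whose value is within [d] of [f y], such a
    step would fall below [f y], a lower bound of all values. *)
Lemma cluster_critical x y : (forall n, step (x n) (x n.+1)) -> clusters_at x y ->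
  critical f y.
Proof.
have arith (a b c p d : R) : d <= p -> a - b <= - p -> b - c < d -> c <= a -> False by lra.
move=> st xy; apply/criticalE; apply: contrapT => gy.
have m0 := half_grad_neq0_dim gy.
have [sigma [M [s0 M0 hs]]] := choose_A_spectrum_nonzero C2F tau01 deltaP m0 (half_grad_neq0_F gy).
pose e1 := enorm (g y) / 2; have e10 : 0 < e1 by rewrite divr_gt0// enorm_gt0.
pose eps := Num.min sigma (e1 ^+ 2 / M).
have eps0 : 0 < eps by rewrite lt_min s0 divr_gt0// exprn_gt0.
have [rho rho0 arm] := armijo_uniform C2F y eps0.
have [N hN] : exists N, 2%:R ^- N <= rho.
  have rV0 : 0 <= rho^-1 by rewrite invr_ge0 ltW.
  exists (Num.bound rho^-1); rewrite -[leRHS]invrK lef_pV2 ?posrE ?exprn_gt0 ?invr_gt0//.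
  by apply: le_trans (ltW (archi_boundP rV0)) _; rewrite -natrX ler_nat ltnW// ltn_expl.
pose d := 2%:R ^- N * eps; have d0 : 0 < d by rewrite mulr_gt0// invr_gt0 exprn_gt0.
have gnear : \forall z \near y, e1 <= enorm (g z).
  have /cvgrPdist_lt/(_ _ e10) := enorm_half_grad_continuous C2F (x:=y).
  apply: filterS => z; rewrite /e1; move: (enorm (g z)) (enorm (g y)) => a b.
  by rewrite ltr_norml => /andP[_ h]; lra.
have rnear : \forall z \near y, `|z - y| < rho.
  by apply/nbhs_ballP; exists rho => //= z; rewrite -ball_normE/= distrC.
have cf : {for y, continuous f} := (C1s_sqnormF C2F).1 y.
have [n [_ fn [hsn [gn rn]]]] := cluster_near_value 0%N xy cf d0
  (filterI hs (filterI gnear rnear)).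
have gx : g (x n) <> 0.
  by move=> gx; move: gn; rewrite gx (_ : enorm 0 = 0) ?leNgt ?e10//; apply/eqP; rewrite enorm_eq0.
have [wh [gamma [[g0 harm hmax xE] [wh1 _ h]]]] := step_direction C2F (st n) gx s0 M0 hsn.
have epsd : eps <= dotv wh (g (x n)).
  apply: le_trans h; rewrite /eps le_min !ge_min lexx/=.
  apply/orP; right; rewrite ler_pM2r ?invr_gt0//.
  by rewrite ler_sqr ?nnegrE ?enorm_ge0// ltW.
have gammaN : 2%:R ^- N <= gamma.
  by apply: hmax; apply: arm => //; rewrite hN invr_gt0 exprn_gt0.
have dd : d <= gamma * dotv wh (g (x n)).
  by rewrite /d ler_pM// ?invr_ge0 ?exprn_ge0// ltW.
have := cluster_value_le xy cf (fun k => step_le (st k)) n.+1.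
move: harm fn; rewrite /armijo -/(g (x n)) -xE mulNr ltr_norml => harm /andP[_ fn].
exact: arith dd harm fn.
Qed.

(** The infimum may fail to be attained, but any larger number leaves room for an admissible
    exponent. The inequality [lojasiewicz_at] makes the set of exponents nonempty, so that the
    infimum is genuine. *)
Lemma loj_exponent_lt (y : 'cV[R]_m) (b : R) : lojasiewicz_at f y -> loj_exponent f y < b ->
  exists mu C : R, [/\ 0 < mu, mu < b, 0 < C &
    \forall x \near y, `|f x - f y| `^ mu <= C * enorm (grad f x)].
Proof.
move=> [mu1 [/andP[m0 m1] [C1 [C10 h1]]]] lb.
have b0 : 0 < b - loj_exponent f y by rewrite subr_gt0.
pose S := [set mu : R | 0 < mu /\ exists C : R, 0 < C /\
  \forall x \near y, `|f x - f y| `^ mu <= C * enorm (grad f x)].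
have Sinf : has_inf S.
  split; first by exists mu1; split=> //; exists C1.
  by exists 0 => mu [/ltW].
have [mu [mu0 [C [C0 h]]] mub] := inf_adherent b0 Sinf.
by exists mu, C; split=> //; move: mub; rewrite -/(loj_exponent f y) addrCA subrr addr0.
Qed.

Lemma near_norm_lt (y : 'cV[R]_m) (P : 'cV[R]_m -> Prop) : (\forall x \near y, P x) ->
  exists2 rho : R, 0 < rho & forall x, `|x - y| < rho -> P x.
Proof.
move=> /nbhs_ballP[rho /= rho0 hr]; exists rho => // x xr.
by apply: hr; rewrite -ball_normE/= distrC.
Qed.

Lemma descent_near (y : 'cV[R]_m) : critical f y -> lojasiewicz_at f y ->
  loj_exponent f y * (1 + tau) < 1 ->
  exists a theta rho : R, [/\ 0 < a, 0 < theta < 1, 0 < rho &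
    forall x x', `|x - y| < rho -> step x x' -> f y < f x ->
      a * (f x - f y) `^ theta * `|x' - x| <= f x - f x'].
Proof.
move=> cy loj; have [t0 t1] := andP tau01; have t10 : 0 < 1 + tau by lra.
rewrite -ltr_pdivlMr// => le1.
have [mu [C [mu0 mub C0 hmu]]] := loj_exponent_lt loj le1.
have mu1 : mu * (1 + tau) < 1 by rewrite -ltr_pdivlMr.
have gbound x : `|f x - f y| `^ mu <= C * enorm (grad f x) -> f y < f x ->
    g x <> 0 /\ (f x - f y) `^ mu / (2 * C) <= enorm (g x).
  move=> hx fxy; have u0 : 0 < f x - f y by rewrite subr_gt0.
  move: hx; rewrite (gtr0_norm u0) grad_sqnormF// enormZ ger0_norm// mulrA [C * 2]mulrC => hx.
  split; last by rewrite ler_pdivrMr ?mulr_gt0// mulrC.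
  move=> gx; move: hx; rewrite gx (_ : enorm 0 = 0); last by apply/eqP; rewrite enorm_eq0.
  by rewrite mulr0 leNgt powR_gt0.
have [m0|m0] := posnP m.
  have E (x : 'cV[R]_m) : x = y.
    by apply/matrixP => i; exfalso; move: (i); rewrite m0 => -[].
  exists 1, 2^-1, 1; split=> //; first by apply/andP; split; lra.
  by move=> x x' _ _; rewrite (E x) ltxx.
have [Fy|Fy] := eqVneq (F y) 0.
  have fy0 : f y = 0 by rewrite /sqnormF Fy sqr_enorm dotv0l.
  have [k [M [k0 M0 hs]]] := choose_A_spectrum_zero C2F tau01 deltaP m0 Fy.
  have [rho rho0 hr] := near_norm_lt (filterI hs hmu).
  exists (Num.sqrt (k / M) / (2 * C)), (mu + tau / 4), rho; split=> //.
  - by rewrite divr_gt0 ?mulr_gt0// sqrtr_gt0 divr_gt0.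
  - apply/andP; split; first by rewrite addr_gt0// divr_gt0.
    (* If mu + tau/4 >= 1, then (1 - tau/4)(1 + tau) <= mu (1 + tau) < 1, whereas (1 - tau/4)(1 +
       tau) = 1 + tau (3 - tau)/4 > 1. *)
    rewrite ltNge; apply/negP => h; have : (1 - tau / 4) * (1 + tau) <= mu * (1 + tau).
      by rewrite ler_pM2r//; lra.
    by nra.
  move=> x x' xr st fxy.
  have [hsx /gbound/(_ fxy)[gx gb]] := hr x xr.
  have nF0 : 0 < enorm (F x) by apply: enorm_gt0; apply/eqP/half_grad_neq0_F.
  have s0 : 0 < k * enorm (F x) `^ tau by rewrite mulr_gt0// powR_gt0.
  have := step_descent st gx s0 M0 hsx; apply: le_trans.
  rewrite ler_wpM2r// fy0 subr0; rewrite fy0 subr0 in gb.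
  have fx0 : 0 < f x by rewrite -fy0.
  rewrite powRD; last by rewrite (gt_eqF fx0) implybT.
  (* The spectral bound enters through its square root, and f = |F|^2; so |F|^tau contributes
     f^(tau/4) to the descent estimate. *)
  have PE : (f x `^ (tau / 4)) ^+ 2 = enorm (F x) `^ tau.
    have -> : f x = enorm (F x) `^ 2%:R by rewrite powR_mulrn ?enorm_ge0.
    rewrite -powRrM -powR_mulrn ?powR_ge0// -powRrM.
    by congr (_ `^ _); field.
  rewrite [leRHS](_ : _ = Num.sqrt (k / M) * f x `^ (tau / 4) * enorm (g x)); last first.
    congr (_ * _); rewrite -PE mulrAC sqrtrM; last by rewrite divr_ge0 ?ltW.
    by rewrite sqrtr_sqr ger0_norm ?powR_ge0.
  rewrite [leLHS](_ : _ = Num.sqrt (k / M) * f x `^ (tau / 4) * (f x `^ mu / (2 * C))); last first.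
    by ring.
  by rewrite ler_wpM2l// mulr_ge0 ?sqrtr_ge0 ?powR_ge0.
have [sigma [M [s0 M0 hs]]] := choose_A_spectrum_nonzero C2F tau01 deltaP m0 Fy.
have [rho rho0 hr] := near_norm_lt (filterI hs hmu).
exists (Num.sqrt (sigma / M) / (2 * C)), mu, rho; split=> //.
- by rewrite divr_gt0 ?mulr_gt0// sqrtr_gt0 divr_gt0.
- by rewrite mu0; nra.
move=> x x' xr st fxy; have [hsx /gbound/(_ fxy)[gx gb]] := hr x xr.
have := step_descent st gx s0 M0 hsx; apply: le_trans.
rewrite ler_wpM2r// -mulrA ler_wpM2l ?sqrtr_ge0//.
by rewrite mulrC.
Qed.

Lemma bnqn_diverges_or_converges x : bnqn_seq F delta tau x ->
  (forall y, critical f y -> lojasiewicz_at f y) ->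
  (forall y, critical f y -> loj_exponent f y * (1 + tau) < 1) ->
  diverges_or_converges_crit F x.
Proof.
move=> st loj lexp; have [|[y xy]] := diverges_or_clusters x; first by left.
right; exists y; have cy := cluster_critical st xy; split=> //.
have cf : {for y, continuous f} := (C1s_sqnormF C2F).1 y.
have fx k := step_le (st k).
have [a [theta [rho [a0 th01 rho0 h]]]] := descent_near cy (loj _ cy) (lexp _ cy).
apply: (lojasiewicz_trapping xy cf fx a0 th01 rho0).
  by move=> n xn fn; exact: h.
(* A nonstationary step from the value [f y] would go strictly below it, against
   [cluster_value_le]. *)
move=> n fn; apply: (step_stationary (st n)); apply: contrapT => gx.
have := step_lt (st n) gx; rewrite fn ltNge.
by rewrite (cluster_value_le xy cf fx).
Qed.

End sequence.

Theorem theorem11 (R : realType) (m m' : nat) (F : 'cV[R]_m -> 'cV[R]_m') :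
  C2 F ->
  (forall xs, critical (sqnormF F) xs -> lojasiewicz_at (sqnormF F) xs) ->
  (* Part 1 *)
  (forall (tau : R) (delta : 'I_m.+1 -> R) (x : nat -> 'cV[R]_m),
     0 < tau < 1 -> bnqn_params delta -> bnqn_seq F delta tau x ->
     (forall xs, critical (sqnormF F) xs ->
        loj_exponent (sqnormF F) xs * (1 + tau) < 1) ->
     diverges_or_converges_crit F x) /\
  (* Part 2 *)
  (polynomial_map F ->
   exists tau0 : R, 0 < tau0 /\
     forall tau : R, 0 < tau < tau0 ->
       (forall xs, critical (sqnormF F) xs ->
          loj_exponent (sqnormF F) xs * (1 + tau) < 1) /\
       (tau < 1 ->
        forall (delta : 'I_m.+1 -> R) (x : nat -> 'cV[R]_m),
          bnqn_params delta -> bnqn_seq F delta tau x ->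
          diverges_or_converges_crit F x)).
Proof.
move=> C2F loj; split=> [tau delta x tau01 dP st le1|[P FP]].
  exact: (bnqn_diverges_or_converges C2F tau01 dP st loj le1).
have fP : polyfun (sqnormF F).
  rewrite sqnormFE; apply: polyfun_sum => i.
  under [X in polyfun X]eq_fun do rewrite FP.
  by apply: polyfun_mul; exact: polyfun_meval.
have [D D0 hD] := polyfun_uniform_lojasiewicz fP.
pose e : R := (D.*2)%:R^-1.
have e0 : 0 < e by rewrite invr_gt0 ltr0n double_gt0.
have e1 : e < 1 by rewrite invf_lt1 ?ltr0n ?double_gt0// ltr1n; lia.
(* With tau < e = 1/(2D), (1 - e)(1 + tau) < (1 - e)(1 + e) < 1. *)
exists e; split=> // tau /andP[t0 te].
have le1 xs : critical (sqnormF F) xs -> loj_exponent (sqnormF F) xs * (1 + tau) < 1.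
  move=> cxs; have [C C0 hC] := hD xs (loj xs cxs).
  have lee : loj_exponent (sqnormF F) xs <= 1 - e.
    apply: ge_inf; first by exists 0 => mu [/ltW].
    by split; [rewrite subr_gt0|exists C].
  apply: le_lt_trans (_ : (1 - e) * (1 + tau) < 1); last by nra.
  by rewrite ler_wpM2r//; lra.
split=> // t1 delta x dP st.
have tau01 : 0 < tau < 1 by rewrite t0.
exact: (bnqn_diverges_or_converges C2F tau01 dP st loj le1).
Qed.
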